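(* Let $\mathbb{G}$ be a stratified group equipped with a homogeneous distance $d$ and let $\mathbb{M}$ be a Banach homogeneous group equipped with its Banach homogeneous distance $\rho$. Let $A\subset\mathbb{G}$ be measurable and let $f\colon A\to\mathbb{M}$ be Lipschitz. Then there is a $\sigma$-porous set $P\subset\mathbb{G}$ such that for every $x\in (A\cap D(A))\setminus P$ the following holds: if $\zeta,\eta\in\mathbb{G}$ are such that $\partial^{+}f(x,\zeta)$ and $\partial^{+}f(x,\eta)$ exist, then for every $a,b>0$ the directional derivative $\partial^{+}f(x,\delta_a\zeta\,\delta_b\eta)$ exists and \[ \partial^{+}f(x,\delta_{a}\zeta\,\delta_{b}\eta)=\delta_{a}\partial^{+}f(x,\zeta)\,\delta_{b}\partial^{+}f(x,\eta). \]
   Context: **Banach homogeneous groups.** A Banach Lie algebra is a (real) Banach space $\mathbb{M}$ with norm $|\cdot|$ and a continuous, bilinear, skew-symmetric bracket $[\cdot,\cdot]$ satisfying the Jacobi identity. It is nilpotent of step $\nu\in\mathbb{N}$ if all iterated left-nested brackets of $\nu+1$ elements vanish and some iterated left-nested bracket of $\nu$ elements is nonzero. It carries the group operation $xy=x+y+\sum_{m=2}^{\nu}P_m(x,y)$ given by the truncated Baker-Campbell-Hausdorff series ($P_m$ is the homogeneous term of degree $m$, written with iterated brackets; e.g. $P_2(x,y)=[x,y]/2$); the identity is $0$ and $x^{-1}=-x$. $\mathbb{M}$ is a Banach homogeneous group if there are closed subspaces $H_1,\dots,H_\nu$ with $\mathbb{M}=H_1\oplus\cdots\oplus H_\nu$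 (the sum map $H_1\times\cdots\times H_\nu\to\mathbb{M}$ is a continuous linear bijection), $[x,y]\in H_{i+j}$ for $x\in H_i,y\in H_j$, $i+j\le\nu$, and $[x,y]=0$ if $i+j>\nu$. Let $\pi_i\colon\mathbb{M}\to H_i$ be the projections. Dilations $\delta_r$, $r>0$, are the linear maps acting as multiplication by $r^i$ on $H_i$. Fixed positive constants $\sigma_1=1,\sigma_2,\dots,\sigma_\nu$ are chosen so that the Banach homogeneous norm $\|x\|=\max_{1\le i\le\nu}\sigma_i|\pi_i(x)|^{1/i}$ satisfies $\|xy\|\le\|x\|+\|y\|$ (such constants exist); the Banach homogeneous distance is $\rho(x,y)=\|x^{-1}y\|$. **Stratified groups.** A stratified group $\mathbb{G}$ is a finite dimensional Banach homogeneous group, with layers $\mathbb{G}=V_1\oplus\cdots\oplus V_s$, such that $[V_1,V_j]=V_{j+1}$ for $j\ge1$ and $V_j=\{0\}$ for $j>s$. A homogeneous distance $d$ on $\mathbb{G}$ is a distance with $d(zx,zy)=d(x,y)$ and $d(\delta_rx,\delta_ry)=r\,d(x,y)$ for all $x,y,z\in\mathbb{G}$, $r>0$. $\mu$ denotes a Haar measure on $\mathbb{G}$. ''Measurable'' refers to $\mu$, and ''Lipschitz'' refers to $d$ and $\rho$. **Density points.** $D(A)$ is the set of $x\in\mathbb{G}$ with $\lim_{r\downarrow0}\mu(A\cap B(x,r))/\mu(B(x,r))=1$, where $B(x,r)$ is the open $d$-ball. **Directional derivatives.** Points $\zeta_x^t\in\mathbb{G}$, $t>0$, approximate in $A$ the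 direction $\zeta\in\mathbb{G}$ at $x$ if $x\zeta_x^t\in A$ for every $t>0$ and $d(\zeta_x^t,\delta_t\zeta)/t\to0$ as $t\downarrow0$. Let $f\colon A\to\mathbb{M}$, $x\in A$, and suppose there exist points approximating in $A$ the direction $\zeta$ at $x$. Then $f$ is differentiable at $x$ in direction $\zeta$, with directional derivative $\partial^+f(x,\zeta)\in\mathbb{M}$ (and one says that $\partial^+f(x,\zeta)$ exists), if for every choice $t\mapsto\zeta_x^t$ of points approximating in $A$ the direction $\zeta$ at $x$ one has $\lim_{t\downarrow0}\delta_{1/t}\big(f(x)^{-1}f(x\zeta_x^t)\big)=\partial^+f(x,\zeta)$. The same definition is used for $\zeta=0$. **Porosity.** A set $E$ in a metric space $(M,\varrho)$ is porous at $a\in M$ with constant $\Lambda>0$ if there is a sequence $x_n\to a$ with $B(x_n,\Lambda\varrho(a,x_n))\cap E=\emptyset$ for every $n\in\mathbb{N}$. $E$ is porous if it is porous at each $a\in E$ with $\Lambda$ independent of $a$; $E$ is $\sigma$-porous if it is a countable union of porous sets. In $\mathbb{G}$ these notions refer to $d$. *)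

(* Defs.v *)
From HB Require Import structures.
From mathcomp Require Import all_boot all_order all_algebra.
From mathcomp Require Import all_classical all_reals all_analysis.

Set Implicit Arguments.
Unset Strict Implicit.
Unset Printing Implicit Defensive.

Import Order.TTheory GRing.Theory Num.Theory.
Import numFieldNormedType.Exports.

Local Open Scope classical_set_scope.
Local Open Scope ring_scope.

Definition is_subspace (R : realType) (V : lmodType R) (S : set V) : Prop :=
  S 0 /\ forall (a : R) (x y : V), S x -> S y -> S (a *: x + y).

Definition linear_span (R : realType) (V : lmodType R) (S : set V) : set V :=
  smallest (@is_subspace R V) S.

Record banach_lie_algebra (R : realType) := BanachLieAlgebra {
  bla_space :> completeNormedModType R;
  bracket : bla_space -> bla_space -> bla_space;
  bracket_linearl : forall y : bla_space, linear (fun x => bracket x y);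
  bracket_linearr : forall x : bla_space, linear (bracket x);
  bracket_skew : forall x y : bla_space, bracket x y = - bracket y x;
  bracket_jacobi : forall x y z : bla_space,
    bracket x (bracket y z) + bracket y (bracket z x)
      + bracket z (bracket x y) = 0;
  bracket_continuous :
    continuous (fun p : bla_space * bla_space => bracket p.1 p.2) }.

(* [:: x1; x2; ...; xk] |-> [..[[x1, x2], x3], .., xk] *)
Definition nested_bracket (R : realType) (L : banach_lie_algebra R)
    (s : seq L) : L :=
  if s is x :: s' then foldl (@bracket R L) x s' else 0.

(* The case nu = 0 is excluded: the empty nested bracket is 0. *)
Definition nilpotent_of_step (R : realType) (L : banach_lie_algebra R)
    (nu : nat) : Prop :=
  (forall s : seq L, size s = nu.+1 -> nested_bracket s = 0) /\
  (exists s : seq L, size s = nu /\ nested_bracket s <> 0).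

(* Homogeneous term of degree m of log (exp x exp y), in Dynkin's form
     sum_(1 <= n <= m) (-1)^(n-1) / (n m)
       sum_(p_i + q_i > 0, sum_i (p_i + q_i) = m)
         [x^p_1 y^q_1 .. x^p_n y^q_n] / prod_i (p_i! q_i!)
   with left-nested brackets. The exponents p_i, q_i are at most m. *)
Definition bch_term (R : realType) (L : banach_lie_algebra R)
    (m : nat) (x y : L) : L :=
  \sum_(1 <= n < m.+1)
   \sum_(pq : {ffun 'I_n -> 'I_m.+1 * 'I_m.+1} |
         [forall i, (0 < (pq i).1 + (pq i).2)%N] &&
         ((\sum_i ((pq i).1 + (pq i).2))%N == m))
    ((-1) ^+ n.-1 /
       (n * m * \prod_i ((pq i).1`! * (pq i).2`!))%:R : R) *:
    nested_bracket
      (flatten [seq nseq (pq i).1 x ++ nseq (pq i).2 y | i <- enum 'I_n]).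

(* Layers are indexed from 1; the value of [layer] outside 1 <= i <= step is
   not used. As the layers are subspaces, the sum map is always linear and
   continuous, so only its bijectivity is required. *)
Record banach_homogeneous_group (R : realType) := BanachHomogeneousGroup {
  bhg_algebra :> banach_lie_algebra R;
  step : nat;
  layer : nat -> set bhg_algebra;
  step_nilpotent : nilpotent_of_step bhg_algebra step;
  layer_subspace : forall i, (1 <= i <= step)%N -> is_subspace (layer i);
  layer_closed : forall i, (1 <= i <= step)%N -> closed (layer i);
  layer_direct_sum :
    set_bij
      [set h : 'I_step -> bhg_algebra | forall i : 'I_step, layer i.+1 (h i)]
      setT (fun h => \sum_i h i);
  layer_bracket : forall i j (x y : bhg_algebra),
    (1 <= i)%N -> (1 <= j)%N -> (i + j <= step)%N ->
    layer i x -> layer j y -> layer (i + j) (bracket x y);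
  layer_bracket0 : forall i j (x y : bhg_algebra),
    (1 <= i <= step)%N -> (1 <= j <= step)%N -> (step < i + j)%N ->
    layer i x -> layer j y -> bracket x y = 0 }.

Arguments layer {R} M i _ : rename.

Section homogeneous_group_operations.
Context {R : realType} (M : banach_homogeneous_group R).
Implicit Types (x y : M) (r : R).

(* [layer_proj i] is the projection on layer i + 1. *)
Definition layer_proj (i : 'I_(step M)) x : M :=
  ('pinv_(fun=> fun=> 0)
     [set h : 'I_(step M) -> M | forall j : 'I_(step M), layer M j.+1 (h j)]
     (fun h => \sum_j h j)) x i.

Definition gmul x y : M :=
  x + y + \sum_(2 <= m < (step M).+1) bch_term m x y.

Definition ginv x : M := - x.

Definition dilation r x : M := \sum_(i < step M) r ^+ i.+1 *: layer_proj i x.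

Definition hnorm (sigma : nat -> R) x : R :=
  \big[Num.max/0]_(i < step M) (sigma i.+1 * `|layer_proj i x| `^ (i.+1%:R^-1)).

Definition hnorm_constants (sigma : nat -> R) : Prop :=
  [/\ sigma 1%N = 1,
      forall i, (1 <= i <= step M)%N -> 0 < sigma i &
      forall x y, hnorm sigma (gmul x y) <= hnorm sigma x + hnorm sigma y].

Definition hdist (sigma : nat -> R) x y : R := hnorm sigma (gmul (ginv x) y).

End homogeneous_group_operations.

Record stratified_group (R : realType) := StratifiedGroup {
  sg_group :> banach_homogeneous_group R;
  sg_finite_dim : exists (n : nat) (e : 'I_n -> sg_group),
    forall x : sg_group, exists c : 'I_n -> R, x = \sum_i c i *: e i;
  sg_generated : forall j, (1 <= j)%N ->
    linear_span
      [set bracket x y | x in layer sg_group 1 & y in layer sg_group j] =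
    layer sg_group j.+1;
  sg_layer0 : forall j, (step sg_group < j)%N ->
    layer sg_group j = [set 0] }.

Section distances.
Context {R : realType} {T : Type}.
Implicit Types (d : T -> T -> R) (E : set T).

Definition is_distance d : Prop :=
  [/\ forall x y, 0 <= d x y,
      forall x y, d x y = 0 <-> x = y,
      forall x y, d x y = d y x &
      forall x y z, d x z <= d x y + d y z].

Definition dball d (x : T) (r : R) : set T := [set y | d x y < r].

(* The points x_n differ from a: for x_n = a the ball would be empty, and the
   constant sequence a would make every set porous. *)
Definition porous_at d E (Lambda : R) (a : T) : Prop :=
  exists x : nat -> T,
    [/\ (fun n => d (x n) a) @ \oo --> 0,
        forall n, x n <> a &
        forall n, dball d (x n) (Lambda * d a (x n)) `&` E = set0].

Definition porous d E : Prop :=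
  exists2 Lambda : R, 0 < Lambda & forall a, E a -> porous_at d E Lambda a.

Definition sigma_porous d E : Prop :=
  exists2 F : nat -> set T, (forall n, porous d (F n)) & E = \bigcup_n F n.

Definition lipschitz_between {U : Type} (d : T -> T -> R) (rho : U -> U -> R)
    (A : set T) (f : T -> U) : Prop :=
  exists L : R, forall x y, A x -> A y -> rho (f x) (f y) <= L * d x y.

End distances.

Definition homogeneous_distance (R : realType) (G : banach_homogeneous_group R)
    (d : G -> G -> R) : Prop :=
  [/\ is_distance d,
      forall x y z : G, d (gmul z x) (gmul z y) = d x y &
      forall (r : R) (x y : G), 0 < r ->
        d (dilation r x) (dilation r y) = r * d x y].

Notation borel T := (g_sigma_algebraType (@open T)).

(* Inner and outer regularity are automatic, as G is a finite dimensional
   normed space. *)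
Definition is_haar (R : realType) (G : stratified_group R)
    (mu : {measure set (borel G) -> \bar R}) : Prop :=
  [/\ forall (x : G) (B : set (borel G)), measurable B ->
        mu [set gmul x y | y in B] = mu B,
      forall K : set G, compact K -> (mu K < +oo)%E &
      forall U : set G, open U -> U !=set0 -> (0 < mu U)%E].

(* The outer measure mu^* extends mu to the mu-measurable sets. *)
Definition density_points (R : realType) (G : stratified_group R)
    (mu : {measure set (borel G) -> \bar R}) (d : G -> G -> R) (A : set G) :
    set G :=
  [set x : G | (fun r : R => (mu^*%mu (A `&` dball d x r) /
                              mu^*%mu (dball d x r))%E) @ 0^'+ --> 1%E].

Section directional_derivatives.
Context {R : realType} (G M : banach_homogeneous_group R).
Variables (d : G -> G -> R) (rho : M -> M -> R) (A : set G) (f : G -> M).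

(* Only the values of z at t > 0 matter. *)
Definition approximates (x zeta : G) (z : R -> G) : Prop :=
  (forall t, 0 < t -> A (gmul x (z t))) /\
  (fun t => d (z t) (dilation t zeta) / t) @ 0^'+ --> 0.

(* D is the directional derivative of f : A -> M at x in direction zeta. *)
Definition is_directional_derivative (x zeta : G) (D : M) : Prop :=
  [/\ A x,
      exists z, approximates x zeta z &
      forall z, approximates x zeta z ->
        (fun t => rho (dilation t^-1 (gmul (ginv (f x)) (f (gmul x (z t))))) D)
          @ 0^'+ --> 0].

End directional_derivatives.

(* Main.v *)
(* Let x be a density point of A. If the derivatives of f at x along zeta and
   eta exist, the increment of f from x to x (t zeta)(t eta) is the product of
   those from x to x (t zeta) and from there along t eta. If at arbitrarily
   small scales the second one were not close to t Deta, then, f being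
   Lipschitz, the same would hold at all points of a ball around x (t zeta) of
   radius comparable to t; such a ball misses the set E of the points where the
   increments along (an approximation of) eta are close to (an approximation
   of) Deta up to a fixed scale. As x belongs to E, the set E is porous at x;
   separability of f(A) leaves countably many sets E to be considered.

   Distances on both groups rely on the associativity of the
   Baker-Campbell-Hausdorff product. The Lie algebra, extended by its degree
   derivation, acts faithfully by nilpotent operators, where the product
   becomes log (exp x exp y). *)

Require Import Defs.
From HB Require Import structures.
From mathcomp Require Import all_boot all_order all_algebra.
From mathcomp Require Import all_classical all_reals all_analysis.
From mathcomp Require Import measurable_realfun.
From mathcomp Require Import ring lra zify.
Import Order.TTheory GRing.Theory Num.Theory.
Import numFieldNormedType.Exports.
Set Implicit Arguments.
Unset Strict Implicit.
Unset Printing Implicit Defensive.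
Local Open Scope classical_set_scope.
Local Open Scope ring_scope.

(** * The algebra of linear endomorphisms *)

(** Dynkin's formula needs an element [Theta] with [Theta, X] = X and [Theta, Y] = Y. The degree
    derivation does not provide one: it multiplies layer i by i, while X and Y have components in
    all layers. A formal parameter t is therefore adjoined, X and Y become X t and Y t, the Euler
    derivation of t serves as [Theta], and t = 1 is substituted at the end.

    The distances are left invariant, so right translations distort them; what survives is that
    conjugation by a fixed element is continuous at the identity. This property, [dg_norm_conj], has
    to be established for each group. On M it follows layer by layer from the continuity of the
    bracket. On G, where d is known only through its axioms, it also needs a comparison of d with
    the linear topology, obtained by compactness.

    M need not be separable. The candidates for a derivative are therefore rescaled increments of f
    between points of a countable subset dense in A. *)

(* The argument [v0_neq0] only serves to make [1 != 0] provable, as required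
   by [algType]. *)
Record endo (R : comNzRingType) (V : lmodType R) (v0 : V)
    (v0_neq0 : v0 != 0) := Endo {
  endo_fun :> V -> V;
  endo_linear : linear endo_fun }.

Section EndoAlgebra.
Variables (R : comNzRingType) (V : lmodType R) (v0 : V) (v0_neq0 : v0 != 0).
Local Notation B := (endo v0_neq0).
Implicit Types f g h : B.

Lemma endoP f g : f =1 g -> f = g.
Proof.
case: f g => [f hf] [g hg] /= /funext fg; rewrite fg in hf *.
by congr Endo; apply: Prop_irrelevance.
Qed.

HB.instance Definition _ := gen_eqMixin B.
HB.instance Definition _ := gen_choiceMixin B.

HB.instance Definition _ f := GRing.isLinear.Build R V V _ f (@endo_linear _ _ _ _ f).

Fact endo_zero_linear : linear (fun _ : V => 0 : V).
Proof. by move=> a u v; rewrite scaler0 addr0. Qed.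
Fact endo_opp_linear f : linear (fun v => - f v).
Proof. by move=> a u v; rewrite linearP opprD scalerN. Qed.
Fact endo_add_linear f g : linear (fun v => f v + g v).
Proof. by move=> a u v; rewrite !linearP scalerDr addrACA. Qed.
Fact endo_one_linear : linear (fun v : V => v).
Proof. by []. Qed.
Fact endo_mul_linear f g : linear (fun v => f (g v)).
Proof. by move=> a u v; rewrite !linearP. Qed.
Fact endo_scale_linear a f : linear (fun v => a *: f v).
Proof. by move=> b u v; rewrite linearP scalerDr !scalerA mulrC. Qed.

Let zero : B := Endo v0_neq0 endo_zero_linear.
Let opp f : B := Endo v0_neq0 (endo_opp_linear f).
Let add f g : B := Endo v0_neq0 (endo_add_linear f g).
Let one : B := Endo v0_neq0 endo_one_linear.
Let mul f g : B := Endo v0_neq0 (endo_mul_linear f g).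
Let scale a f : B := Endo v0_neq0 (endo_scale_linear a f).

Fact endo_addA : associative add.
Proof. by move=> f g h; apply: endoP => v /=; rewrite addrA. Qed.
Fact endo_addC : commutative add.
Proof. by move=> f g; apply: endoP => v /=; rewrite addrC. Qed.
Fact endo_add0 : left_id zero add.
Proof. by move=> f; apply: endoP => v /=; rewrite add0r. Qed.
Fact endo_addN : left_inverse zero opp add.
Proof. by move=> f; apply: endoP => v /=; rewrite addNr. Qed.
HB.instance Definition _ :=
  GRing.isZmodule.Build B endo_addA endo_addC endo_add0 endo_addN.

Fact endo_mulA : associative mul. Proof. by move=> f g h; apply: endoP. Qed.
Fact endo_mul1 : left_id one mul. Proof. by move=> f; apply: endoP. Qed.
Fact endo_mulr1 : right_id one mul. Proof. by move=> f; apply: endoP. Qed.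
Fact endo_mulDl : left_distributive mul +%R.
Proof. by move=> f g h; apply: endoP. Qed.
Fact endo_mulDr : right_distributive mul +%R.
Proof. by move=> f g h; apply: endoP => v /=; rewrite linearD. Qed.
Fact endo_one_neq0 : one != 0.
Proof. by apply: contra_neq v0_neq0 => /(congr1 (fun f : B => f v0)). Qed.
HB.instance Definition _ := GRing.Zmodule_isNzRing.Build B
  endo_mulA endo_mul1 endo_mulr1 endo_mulDl endo_mulDr endo_one_neq0.

Fact endo_scaleA a b f : scale a (scale b f) = scale (a * b) f.
Proof. by apply: endoP => v /=; rewrite scalerA. Qed.
Fact endo_scale1 : left_id 1 scale.
Proof. by move=> f; apply: endoP => v /=; rewrite scale1r. Qed.
Fact endo_scaleDr : right_distributive scale +%R.
Proof. by move=> a f g; apply: endoP => v /=; rewrite scalerDr. Qed.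
Fact endo_scaleDl f : {morph scale^~ f : a b / a + b}.
Proof. by move=> a b; apply: endoP => v /=; rewrite scalerDl. Qed.
HB.instance Definition _ := GRing.Zmodule_isLmodule.Build R B
  endo_scaleA endo_scale1 endo_scaleDr endo_scaleDl.

Fact endo_scaleAl a f g : a *: (f * g) = (a *: f) * g.
Proof. exact: endoP. Qed.
HB.instance Definition _ := GRing.Lmodule_isLalgebra.Build R B endo_scaleAl.
Fact endo_scaleAr a f g : a *: (f * g) = f * (a *: g).
Proof. by apply: endoP => v /=; rewrite linearZ. Qed.
HB.instance Definition _ := GRing.Lalgebra_isAlgebra.Build R B endo_scaleAr.

Lemma endo0E v : (0 : B) v = 0. Proof. by []. Qed.
Lemma endo1E v : (1 : B) v = v. Proof. by []. Qed.
Lemma endoDE f g v : (f + g) v = f v + g v. Proof. by []. Qed.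
Lemma endoNE f v : (- f) v = - f v. Proof. by []. Qed.
Lemma endoME f g v : (f * g) v = f (g v). Proof. by []. Qed.
Lemma endoZE a f v : (a *: f) v = a *: f v. Proof. by []. Qed.
Lemma endo_sumE (I : Type) (r : seq I) (P : pred I) (F : I -> B) v :
  (\sum_(i <- r | P i) F i) v = \sum_(i <- r | P i) F i v.
Proof. by elim/big_rec2: _ => // i x y _ <-; rewrite endoDE. Qed.

End EndoAlgebra.

(** * Truncated exponential and logarithm *)

Section ExpLogPoly.
Variable R : numFieldType.
Implicit Types (p q : {poly R}) (n : nat).

Definition exp_poly n : {poly R} := \poly_(i < n) i`!%:R^-1.

(* The series of [log (1 + 'X)]; its constant term is [0^-1 = 0]. *)
Definition log_poly n : {poly R} := \poly_(i < n) ((-1) ^+ i.-1 / i%:R).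

Lemma dvdXnP n p : reflect (forall i, (i < n)%N -> p`_i = 0) ('X^n %| p).
Proof.
apply: (iffP idP) => [/dvdpP [q ->] i ilt|p0]; first by rewrite coefMXn ilt.
rewrite -[p](poly_take_drop n p) (_ : take_poly n p = 0) ?add0r ?dvdp_mulIr //.
by apply/polyP => i; rewrite coef_take_poly coef0; case: ifP => // /p0.
Qed.

(** Integration in characteristic 0; it lets the two inversion identities for exp and log be checked
    on derivatives. *)
Lemma dvdXn_deriv n p : ('X^n %| p^`()) -> p`_0 = 0 -> ('X^(n.+1) %| p).
Proof.
move=> /dvdXnP dp p0; apply/dvdXnP => -[//|i] ilt.
have /eqP := dp _ ilt; rewrite coef_deriv -mulr_natr mulf_eq0 pnatr_eq0 orbF.
by move/eqP.
Qed.

Lemma exp_poly_deriv n :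
  (exp_poly n.+1)^`() = exp_poly n.+1 - n`!%:R^-1 *: 'X^n.
Proof.
apply/polyP => i; rewrite coefB coefZ coefXn coef_deriv !coef_poly ltnS.
have [ilt|nlt|->] := ltngtP i n.
- rewrite (leqW ilt) mulr0n mulr0 subr0 factS natrM invfM -mulrnAl.
  by rewrite -[X in X * _]mulr_natr mulVf ?mul1r // pnatr_eq0.
- by rewrite mul0rn ifN ?mulr0n ?mulr0 ?subr0 // -leqNgt.
- by rewrite mul0rn mulr1n leqnn mulr1 subrr.
Qed.

Lemma log_poly_deriv n :
  (1 + 'X) * (log_poly n.+1)^`() = 1 - (- 'X) ^+ n.
Proof.
have -> : (log_poly n.+1)^`() = \sum_(i < n) (- 'X) ^+ i.
  rewrite (_ : \sum_(i < n) (- 'X) ^+ i = \sum_(i < n) ((-1) ^+ i) *: 'X^i).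
    rewrite -poly_def; apply/polyP => i; rewrite coef_deriv !coef_poly ltnS.
    case: ifP => _; last by rewrite mul0rn.
    by rewrite -[LHS]mulr_natr divfK // pnatr_eq0.
  by apply: eq_bigr => i _; rewrite -scaleN1r exprZn.
rewrite -[RHS]opprB subrX1 -mulNr; congr (_ * _).
by rewrite opprB opprK.
Qed.

Lemma exp_poly0 n : (exp_poly n.+1)`_0 = 1.
Proof. by rewrite coef_poly /= fact0 invr1. Qed.

Lemma log_poly0 n : (log_poly n)`_0 = 0.
Proof. by rewrite coef_poly invr0 mulr0 if_same. Qed.

(** The constant terms agree, so derivatives are compared modulo X^n. As E is invertible there, they
    may be multiplied by E first, and E times the derivative of log at E - 1 is 1 up to (1 -
    E)^n. *)
Lemma log_exp_poly n :
  'X^n %| log_poly n \Po (exp_poly n - 1) - 'X.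
Proof.
case: n => [|n]; first by rewrite expr0 dvd1p.
set E := exp_poly _; set P := _ \Po _.
have E1 : ('X %| E - 1)%R.
  by rewrite -['X]expr1; apply/dvdXnP => -[|//] _; rewrite coefB exp_poly0 coef1 subrr.
apply: dvdXn_deriv; last first.
  rewrite -horner_coef0 hornerD hornerN hornerX subr0 horner_comp hornerD.
  by rewrite hornerN hornerC !horner_coef0 exp_poly0 subrr horner_coef0 log_poly0.
have cop : coprimep 'X^n E.
  apply: coprimep_expl; rewrite coprimep_sym -['X]subr0 -polyC0 coprimep_XsubC.
  by rewrite /root horner_coef0 exp_poly0 oner_eq0.
rewrite derivB derivX -(Gauss_dvdpr _ cop) mulrBr mulr1 deriv_comp mulrA.
have -> : E * ((log_poly n.+1)^`() \Po (E - 1)) = 1 - (1 - E) ^+ n.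
  have := congr1 (comp_poly (E - 1)) (log_poly_deriv n).
  rewrite comp_polyM comp_polyD comp_polyX comp_polyC addrCA subrr addr0.
  by move=> ->; rewrite comp_polyB comp_polyC rmorphXn /= raddfN /= comp_polyX opprB.
rewrite derivB -polyC1 derivC subr0 exp_poly_deriv -/E polyC1.
rewrite (_ : _ - E = - (n`!%:R^-1 *: 'X^n)
  - (1 - E) ^+ n * (E - n`!%:R^-1 *: 'X^n)); last by ring.
rewrite dvdp_sub ?dvdpNr ?dvdpZr ?invr_eq0 ?pnatr_eq0 -?lt0n ?fact_gt0 //.
by rewrite dvdp_mulr // dvdp_exp2r // -opprB dvdpNr.
Qed.

(** The difference U satisfies (1 + X) U' = U modulo X^n and has no constant term; this differential
    equation determines the coefficients recursively, so they vanish. *)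
Lemma exp_log_poly n :
  'X^n %| exp_poly n \Po log_poly n - (1 + 'X).
Proof.
case: n => [|n]; first by rewrite expr0 dvd1p.
set E := exp_poly _; set L := log_poly _; set U := _ - _.
have XL : 'X %| L.
  by rewrite -['X]expr1; apply/dvdXnP => -[|//] _; rewrite log_poly0.
have : 'X^n %| (1 + 'X) * U^`() - U.
  rewrite derivB derivD -polyC1 derivC derivX add0r deriv_comp exp_poly_deriv -/E.
  rewrite comp_polyB comp_polyZ comp_Xn_poly.
  rewrite (_ : _ - U = - (n`!%:R^-1 *: L ^+ n)
    - (- 'X) ^+ n * (E \Po L - n`!%:R^-1 *: L ^+ n)); last first.
    have -> : (- 'X) ^+ n = 1 - (1 + 'X) * L^`() :> {poly R}.
      by rewrite log_poly_deriv; ring.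
    by rewrite /U; ring.
  rewrite dvdp_sub ?dvdpNr ?dvdpZr ?invr_eq0 ?pnatr_eq0 -?lt0n ?fact_gt0 //.
    by rewrite dvdp_exp2r.
  by rewrite dvdp_mulr // exprNn dvdp_mull.
move=> /dvdXnP dU; apply/dvdXnP => i; elim: i => [_|i IHi ilt].
  rewrite coefB coefD coef1 coefX addr0 -horner_coef0 horner_comp.
  by rewrite !horner_coef0 log_poly0 horner_coef0 exp_poly0 subrr.
have /eqP := dU _ ilt; rewrite coefB mulrDl mul1r coefD coefXM !coef_deriv.
rewrite (IHi (ltnW ilt)) subr0 (_ : (if _ then _ else _) = 0); last first.
  by case: (i) IHi ilt => [//|j] IHj jlt; rewrite /= IHj ?mul0rn // ltnW.
by rewrite addr0 -[_ *+ _]mulr_natr mulf_eq0 pnatr_eq0 orbF => /eqP.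
Qed.
End ExpLogPoly.

Section NilpotentExpLog.
Variables (R : numFieldType) (A : algType R).
Implicit Types (a b u : A) (p q : {poly R}) (n : nat).

Definition aexp n a : A := horner_alg a (exp_poly R n).
Definition alog n u : A := horner_alg u (log_poly R n).

Lemma horner_algE n (E : nat -> R) a :
  horner_alg a (\poly_(i < n) E i) = \sum_(i < n) E i *: a ^+ i.
Proof.
rewrite poly_def rmorph_sum /=; apply: eq_bigr => i _.
by rewrite linearZ /= rmorphXn /= horner_algX mulr_algl.
Qed.

Lemma aexpE n a : aexp n a = \sum_(i < n) i`!%:R^-1 *: a ^+ i.
Proof. exact: horner_algE. Qed.

Lemma alogE n u : alog n u = \sum_(i < n) ((-1) ^+ i.-1 / i%:R) *: u ^+ i.
Proof. exact: (horner_algE _ (fun i => (-1) ^+ i.-1 / i%:R)). Qed.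

Lemma nilpotentW m n a : (m <= n)%N -> a ^+ m = 0 -> a ^+ n = 0.
Proof. by move=> /subnK <- am; rewrite exprD am mulr0. Qed.

Lemma horner_alg_dvd n p q a :
  a ^+ n = 0 -> 'X^n %| p - q -> horner_alg a p = horner_alg a q.
Proof.
move=> an /dvdpP [r pq]; apply/eqP; rewrite -subr_eq0 -rmorphB pq rmorphM.
by rewrite rmorphXn /= horner_algX an mulr0.
Qed.

Lemma horner_alg_comp p q a :
  horner_alg a (p \Po q) = horner_alg (horner_alg a q) p.
Proof.
elim/poly_ind: p => [|p c IHp]; first by rewrite comp_poly0 !rmorph0.
by rewrite comp_polyD comp_polyM comp_polyX comp_polyC !rmorphD !rmorphM
   /= IHp !horner_algC horner_algX.
Qed.

Lemma alogK n a : a ^+ n = 0 -> alog n (aexp n a - 1) = a.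
Proof.
move=> an; rewrite -[RHS]horner_algX -(horner_alg_dvd an (log_exp_poly R n)).
by rewrite horner_alg_comp rmorphB rmorph1.
Qed.

Lemma aexp_log n u : u ^+ n = 0 -> aexp n (alog n u) = 1 + u.
Proof.
move=> un; rewrite (_ : 1 + u = horner_alg u (1 + 'X)); last first.
  by rewrite rmorphD rmorph1 /= horner_algX.
by rewrite -(horner_alg_dvd un (exp_log_poly R n)) horner_alg_comp.
Qed.

Lemma aexp_cutoff m n a : (m <= n)%N -> a ^+ m = 0 -> aexp n a = aexp m a.
Proof.
move=> mn am; apply: horner_alg_dvd am _; apply/dvdXnP => i im.
by rewrite coefB !coef_poly im (leq_trans im mn) subrr.
Qed.

Lemma aexp_inj n a b : a ^+ n = 0 -> b ^+ n = 0 -> aexp n a = aexp n b -> a = b.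
Proof. by move=> an bn ab; rewrite -(alogK an) ab alogK. Qed.

Lemma aexp0 n : aexp n.+1 0 = 1.
Proof.
rewrite aexpE big_ord_recl /= fact0 invr1 scale1r expr0 big1 ?addr0 // => i _.
by rewrite expr0n scaler0.
Qed.

Lemma nilpotentD m n a b : GRing.comm a b -> a ^+ m = 0 -> b ^+ n = 0 ->
  (a + b) ^+ (m + n) = 0.
Proof.
move=> cab am bn; rewrite exprDn_comm // big1 // => i _.
have [ni|lni] := leqP n i; first by rewrite (nilpotentW ni bn) mulr0 mul0rn.
by rewrite (nilpotentW _ am) ?mul0r ?mul0rn //; lia.
Qed.

(** The truncation is doubled because a + b is only known to be nilpotent of order 2n. The binomial
    formula gives the terms with i + j < 2n of the product; in the others i or j is at least n. *)
Lemma aexpD n a b : GRing.comm a b -> a ^+ n = 0 -> b ^+ n = 0 ->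
  aexp (n + n) (a + b) = aexp n a * aexp n b.
Proof.
move=> cab an bn; rewrite -(aexp_cutoff (leq_addr n n) an).
rewrite -(aexp_cutoff (leq_addr n n) bn); set M := (n + n)%N.
pose F i j := (i`!%:R^-1 *: a ^+ i) * (j`!%:R^-1 *: b ^+ j).
have F0 i j : (M <= i + j)%N -> F i j = 0.
  move=> Mij; rewrite /F; have [ni|lni] := leqP n i.
    by rewrite (nilpotentW ni an) scaler0 mul0r.
  by rewrite (@nilpotentW n j b) ?scaler0 ?mulr0 //; lia.
transitivity (\sum_(k < M) \sum_(j < M | (j <= k)%N) F (k - j)%N j).
  rewrite aexpE; apply: eq_bigr => k _; rewrite exprDn_comm // scaler_sumr.
  rewrite (big_ord_widen_cond M xpredT
    (fun j => k`!%:R^-1 *: ((a ^+ (k - j) * b ^+ j) *+ 'C(k, j)))) //.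
  apply: eq_big => // j; rewrite ltnS => jk.
  rewrite /F -scalerAl -scalerAr -[X in _ *: X = _]scaler_nat !scalerA; congr (_ *: _).
  rewrite -invfM -natrM -(bin_fact jk) mulnC.
  by rewrite natrM invfM divfK 1?mulnC // pnatr_eq0 -lt0n bin_gt0.
rewrite (exchange_big_dep xpredT) //= !aexpE mulr_sumr; apply: eq_bigr => j _.
rewrite mulr_suml -(big_mkord xpredT (fun i => F i j)).
rewrite (@big_cat_nat _ _ _ (M - j)) ?leq_subr //= [X in _ + X]big_nat_cond.
rewrite [X in _ + X]big1 ?addr0; last by move=> i ?; apply: F0; lia.
rewrite -(big_mkord (fun i => (j <= i)%N) (fun k => F (k - j)%N j)).
rewrite (@big_cat_nat _ _ _ j) ?leq0n 1?ltnW //= big_nat_cond big1 ?add0r; last first.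
  by move=> i; lia.
rewrite -{1}[nat_of_ord j]add0n big_addn big_nat_cond [RHS]big_nat_cond.
apply: eq_big => i; first by rewrite leq_addl.
by rewrite addnK.
Qed.

Lemma aexpN n a : (0 < n)%N -> a ^+ n = 0 -> aexp n (- a) * aexp n a = 1.
Proof.
move=> n0 an; rewrite -aexpD ?addNr //.
- by rewrite -(prednK n0) aexp0.
- by rewrite /GRing.comm mulNr mulrN.
- by rewrite exprNn an mulr0.
Qed.

End NilpotentExpLog.

(** * Dynkin's formula in a nilpotent associative algebra *)

Section ListSums.
Variables (T : finType) (V : nmodType).

(** Lists replace the finite functions of [bch_term] so that a sum over n blocks can be treated by
    induction on n. *)
Fixpoint sum_lists n (F : seq T -> V) : V :=
  if n is n'.+1 then \sum_t sum_lists n' (fun l => F (t :: l)) else F [::].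

Lemma sum_ffunE n (P : pred (seq T)) (F : seq T -> V) :
  \sum_(f : {ffun 'I_n -> T} | P [seq f i | i <- enum 'I_n])
    F [seq f i | i <- enum 'I_n] =
  sum_lists n (fun l => if P l then F l else 0).
Proof.
rewrite big_mkcond /=; set F1 := fun l => if P l then F l else 0.
rewrite -[LHS]/(\sum_f F1 _); move: F1 => F' {P F}.
elim: n F' => [|n IHn] F' /=.
  rewrite (big_pred1 (ffun0 (card_ord 0) : {ffun 'I_0 -> T})).
    by have -> : enum 'I_0 = [::] by apply: size0nil; rewrite size_enum_ord.
  by move=> f; apply/esym/eqP/ffunP => -[].
pose h (tg : T * {ffun 'I_n -> T}) : {ffun 'I_n.+1 -> T} :=
  [ffun i => if unlift ord0 i is Some j then tg.2 j else tg.1].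
pose h' (f : {ffun 'I_n.+1 -> T}) := (f ord0, [ffun i => f (lift ord0 i)]).
rewrite (reindex h) /=; last first.
  exists h' => [[t g]|f] _ /=.
    rewrite /h' /h ffunE unlift_none; congr pair.
    by apply/ffunP => i; rewrite !ffunE liftK.
  by apply/ffunP => i; rewrite /h ffunE /=; case: unliftP => [j|] ->; rewrite ?ffunE.
rewrite -(pair_bigA_idem _ (fun t g => F' [seq h (t, g) i | i <- enum 'I_n.+1])) //=;
  last by rewrite addr0.
apply: eq_bigr => t _; rewrite -IHn; apply: eq_bigr => g _; congr F'.
rewrite enum_ordSl /= /h ffunE unlift_none -map_comp; congr cons.
by apply: eq_map => i /=; rewrite ffunE liftK.
Qed.

Lemma eq_sum_lists n (F F' : seq T -> V) :
  (forall l, size l = n -> F l = F' l) -> sum_lists n F = sum_lists n F'.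
Proof.
elim: n F F' => [|n IHn] F F' FF' /=; first exact: FF'.
by apply: eq_bigr => t _; apply: IHn => l ln; apply: FF'; rewrite /= ln.
Qed.

Lemma sum_lists0 n (F : seq T -> V) :
  (forall l, size l = n -> F l = 0) -> sum_lists n F = 0.
Proof.
move=> F0; rewrite (@eq_sum_lists n F (fun=> 0)) //.
by elim: n {F0} => //= n IHn; rewrite big1.
Qed.

Lemma sum_lists_sum n (I : finType) (F : I -> seq T -> V) :
  sum_lists n (fun l => \sum_i F i l) = \sum_i sum_lists n (F i).
Proof.
elim: n F => [//|n IHn] F /=.
by rewrite exchange_big /=; apply: eq_bigr => t _; rewrite IHn.
Qed.

End ListSums.

Lemma morph_sum_lists (T : finType) (V W : nmodType) (f : V -> W) n
    (F : seq T -> V) : f 0 = 0 -> {morph f : a b / a + b} ->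
  f (sum_lists n F) = sum_lists n (fun l => f (F l)).
Proof.
move=> f0 fD; elim: n F => [//|n IHn] F /=.
by rewrite (big_morph _ fD f0); apply: eq_bigr => t _.
Qed.

Section Commutators.
Variables (R : numFieldType) (B : algType R).
Implicit Types (a b z : B) (w s : seq B).

Definition comm_br a b : B := a * b - b * a.

Definition nested_comm s : B := if s is x :: s' then foldl comm_br x s' else 0.

(* The formula of [bch_term], with commutators as brackets. *)
Definition bch_comm m (x y : B) : B :=
  \sum_(1 <= n < m.+1)
   \sum_(pq : {ffun 'I_n -> 'I_m.+1 * 'I_m.+1} |
         [forall i, (0 < (pq i).1 + (pq i).2)%N] &&
         ((\sum_i ((pq i).1 + (pq i).2))%N == m))
    ((-1) ^+ n.-1 /
       (n * m * \prod_i ((pq i).1`! * (pq i).2`!))%:R : R) *: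
    nested_comm
      (flatten [seq nseq (pq i).1 x ++ nseq (pq i).2 y | i <- enum 'I_n]).

Local Notation E := (endo (oner_neq0 B)).

Fact mull_linear z : linear (fun v => z * v).
Proof. by move=> a u v; rewrite mulrDr -scalerAr. Qed.
Fact mulr_linear z : linear (fun v => v * z).
Proof. by move=> a u v; rewrite mulrDl -scalerAl. Qed.

Definition mull_endo z : E := Endo _ (mull_linear z).
Definition mulr_endo z : E := Endo _ (mulr_linear z).
(** The right bracket: left-nested brackets are compositions of such operators. *)
Definition adr z : E := mulr_endo z - mull_endo z.

Lemma adrE z v : adr z v = comm_br v z. Proof. by []. Qed.

Lemma comm_brE z a : comm_br z a = - adr z a.
Proof. by rewrite adrE /comm_br opprB. Qed.

Lemma comm_br_endo z : exists T : E, forall a, comm_br z a = T a.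
Proof. by exists (- adr z) => a; rewrite comm_brE. Qed.

Lemma mull_endoX z n : mull_endo z ^+ n = mull_endo (z ^+ n).
Proof.
elim: n => [|n IHn]; first by apply: endoP => v /=; rewrite mul1r.
by rewrite exprS IHn; apply: endoP => v /=; rewrite mulrA -exprS.
Qed.

Lemma mulr_endoX z n : mulr_endo z ^+ n = mulr_endo (z ^+ n).
Proof.
elim: n => [|n IHn]; first by apply: endoP => v /=; rewrite mulr1.
by rewrite exprS IHn; apply: endoP => v /=; rewrite -mulrA -exprSr.
Qed.

Lemma mull_endo_nil z n : z ^+ n = 0 -> mull_endo z ^+ n = 0.
Proof. by move=> zn; rewrite mull_endoX zn; apply: endoP => v /=; rewrite mul0r. Qed.

Lemma mulr_endo_nil z n : z ^+ n = 0 -> mulr_endo z ^+ n = 0.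
Proof. by move=> zn; rewrite mulr_endoX zn; apply: endoP => v /=; rewrite mulr0. Qed.

Lemma aexp_mull n z v : aexp n (mull_endo z) v = aexp n z * v.
Proof.
rewrite !aexpE endo_sumE mulr_suml; apply: eq_bigr => i _.
by rewrite mull_endoX endoZE /= scalerAl.
Qed.

Lemma aexp_mulr n z v : aexp n (mulr_endo z) v = v * aexp n z.
Proof.
rewrite !aexpE endo_sumE mulr_sumr; apply: eq_bigr => i _.
by rewrite mulr_endoX endoZE /= scalerAr.
Qed.

Lemma mulr_mull_comm z : GRing.comm (mulr_endo z) (- mull_endo z).
Proof.
by rewrite /GRing.comm; apply: endoP => v; rewrite !endoME !endoNE /= mulNr mulrA.
Qed.

Lemma mull_endoN z : - mull_endo z = mull_endo (- z).
Proof. by apply: endoP => v; rewrite endoNE /= mulNr. Qed.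

Lemma adr_nil z n : z ^+ n = 0 -> adr z ^+ (n + n) = 0.
Proof.
move=> zn; apply: nilpotentD; first exact: mulr_mull_comm.
- exact: mulr_endo_nil.
- by rewrite mull_endoN; apply: mull_endo_nil; rewrite exprNn zn mulr0.
Qed.

(** Left and right multiplications by z commute, so the exponential of their difference factors. *)
Lemma aexp_adr n z v : z ^+ n = 0 ->
  aexp (n + n) (adr z) v = aexp n (- z) * v * aexp n z.
Proof.
move=> zn; rewrite aexpD; first last.
- by rewrite mull_endoN; apply: mull_endo_nil; rewrite exprNn zn mulr0.
- exact: mulr_endo_nil.
- exact: mulr_mull_comm.
by rewrite endoME mull_endoN aexp_mull aexp_mulr.
Qed.

End Commutators.

Section DynkinFormula.
Variables (R : numFieldType) (B : algType R) (X Y Theta : B) (N : nat).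
Hypothesis ThetaX : comm_br Theta X = X.
Hypothesis ThetaY : comm_br Theta Y = Y.

Definition is_letter (z : B) := (z == X) || (z == Y).

Hypothesis nilXY : forall w : seq B,
  all is_letter w -> size w = N -> \prod_(z <- w) z = 0.

Implicit Types (w s : seq B) (k m n : nat).

(** The filtration by degree of the algebra generated by X and Y. Its N-th term is zero by
    [nilXY]. *)
Definition word_span k (b : B) : Prop := exists2 I : seq (R * seq B),
  all (fun i => all is_letter i.2 && (k <= size i.2)%N) I &
  b = \sum_(i <- I) i.1 *: \prod_(z <- i.2) z.

Lemma word_span0 k : word_span k 0.
Proof. by exists [::] => //; rewrite big_nil. Qed.

Lemma word_spanD k a b : word_span k a -> word_span k b -> word_span k (a + b).
Proof.
move=> [I hI ->] [J hJ ->]; exists (I ++ J); first by rewrite all_cat hI.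
by rewrite big_cat.
Qed.

Lemma word_spanZ k c a : word_span k a -> word_span k (c *: a).
Proof.
move=> [I hI ->]; exists [seq (c * i.1, i.2) | i <- I].
  by rewrite all_map; apply: sub_all hI => -[].
by rewrite big_map scaler_sumr; apply: eq_bigr => i _; rewrite scalerA.
Qed.

Lemma word_spanB k a b : word_span k a -> word_span k b -> word_span k (a - b).
Proof. by move=> ha hb; rewrite -scaleN1r; apply/word_spanD/word_spanZ. Qed.

Lemma word_span_sum k (I : eqType) (r : seq I) (P : pred I) (F : I -> B) :
  (forall i, i \in r -> P i -> word_span k (F i)) ->
  word_span k (\sum_(i <- r | P i) F i).
Proof.
move=> hF; rewrite big_seq_cond; apply: big_ind => [|a b|i /andP[]].
- exact: word_span0.
- exact: word_spanD.
- exact: hF.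
Qed.

Lemma word_spanM k m a b :
  word_span k a -> word_span m b -> word_span (k + m) (a * b).
Proof.
move=> [I /allP hI ->] [J /allP hJ ->]; rewrite mulr_suml.
apply: word_span_sum => i iI _; rewrite mulr_sumr.
apply: word_span_sum => j jJ _; rewrite -scalerAl -scalerAr !scalerA -big_cat.
apply: word_spanZ; have /andP[li si] := hI _ iI; have /andP[lj sj] := hJ _ jJ.
exists [:: (1, i.2 ++ j.2)]; last by rewrite big_seq1 scale1r.
by rewrite /= all_cat li lj size_cat leq_add.
Qed.

Lemma word_spanW k m a : (k <= m)%N -> word_span m a -> word_span k a.
Proof.
move=> km [I hI ->]; exists I => //; apply: sub_all hI => i /andP[-> /=].
exact: leq_trans.
Qed.

Lemma word_span1 : word_span 0 1.
Proof. by exists [:: (1, [::])] => //; rewrite big_seq1 big_nil scale1r. Qed.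

Lemma word_spanX k a n : word_span k a -> word_span (k * n) (a ^+ n).
Proof.
move=> ha; elim: n => [|n IHn]; first by rewrite muln0; apply: word_span1.
by rewrite mulnS exprS; apply: word_spanM.
Qed.

Lemma word_span_letter z : is_letter z -> word_span 1 z.
Proof.
move=> lz; exists [:: (1, [:: z])]; first by rewrite /= lz.
by rewrite big_seq1 big_seq1 scale1r.
Qed.

Lemma long_word0 w : all is_letter w -> (N <= size w)%N -> \prod_(z <- w) z = 0.
Proof.
move=> lw Nw; rewrite -(cat_take_drop N w) big_cat /= nilXY ?mul0r //.
  by apply/allP => z /mem_take; apply/allP.
by rewrite size_takel.
Qed.

Lemma word_spanN a : word_span N a -> a = 0.
Proof.
move=> [I /allP hI ->]; rewrite big_seq big1 // => i iI.
by have /andP[li si] := hI _ iI; rewrite long_word0 ?scaler0.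
Qed.

Lemma word_span_nil a : word_span 1 a -> a ^+ N = 0.
Proof. by move/(word_spanX N); rewrite mul1n; apply: word_spanN. Qed.

Lemma word_span_comm k m a b :
  word_span k a -> word_span m b -> word_span (k + m) (comm_br a b).
Proof.
by move=> ha hb; apply: word_spanB; last rewrite addnC; apply: word_spanM.
Qed.

Lemma word_span_foldl k a s : all is_letter s -> word_span k a ->
  word_span (k + size s) (foldl (@comm_br R B) a s).
Proof.
elim: s k a => [|z s IHs] k a /=; first by rewrite addn0.
move=> /andP[lz ls] ha; rewrite addnS -addSn -addn1; apply: IHs => //.
exact/word_span_comm/word_span_letter.
Qed.

Lemma word_span_nested s : all is_letter s -> word_span (size s) (nested_comm s).
Proof.
case: s => [|z s] /=; first by move=> _; apply: word_span0.
by move=> /andP[lz ls]; rewrite -add1n; apply/word_span_foldl/word_span_letter.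
Qed.

Local Notation D := (comm_br Theta).

Lemma comm_brM a b : D (a * b) = D a * b + a * D b.
Proof. by rewrite /comm_br mulrBl mulrBr !mulrA addrA subrK. Qed.

Lemma comm_brB a b : D (a - b) = D a - D b.
Proof.
by rewrite !(comm_brE Theta); move: (adr Theta) => f; rewrite linearB opprD.
Qed.

Lemma is_letterP z : is_letter z -> D z = z.
Proof. by case/orP => /eqP ->. Qed.

Lemma D_word w : all is_letter w ->
  D (\prod_(z <- w) z) = (size w)%:R *: \prod_(z <- w) z.
Proof.
elim: w => [|z w IHw] /=.
  by rewrite big_nil /comm_br mulr1 mul1r subrr scale0r.
move=> /andP[lz lw]; rewrite big_cons comm_brM is_letterP // IHw //.
by rewrite -scalerAr -{1}[z * _]scale1r -scalerDl -natr1 addrC.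
Qed.

Lemma D_foldl a s c : all is_letter s -> D a = c *: a ->
  D (foldl (@comm_br R B) a s) =
    (c + (size s)%:R) *: foldl (@comm_br R B) a s.
Proof.
elim: s a c => [|z s IHs] a c /=; first by rewrite addr0.
move=> /andP[lz ls] Da; rewrite (IHs _ (c + 1)) //; last first.
  rewrite [comm_br a z]/comm_br comm_brB !comm_brM Da is_letterP //.
  rewrite -!scalerAl -!scalerAr scalerDl scale1r scalerBr [RHS]addrACA opprD.
  by rewrite [- (z * a) - _]addrC.
by rewrite -natr1 addrCA addrC.
Qed.

Lemma D_nested s : all is_letter s -> D (nested_comm s) = (size s)%:R *: nested_comm s.
Proof.
case: s => [|z s] /=; first by rewrite scale0r /comm_br mulr0 mul0r subrr.
by move=> /andP[lz ls]; rewrite (@D_foldl _ _ 1) ?scale1r ?is_letterP // -nat1r.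
Qed.

(** Since [Theta, z] = z for a letter z, every nested bracket may start at [Theta], and so is the
    value at [Theta] of an operator. *)
Lemma nested_foldl s : all is_letter s -> (0 < size s)%N ->
  nested_comm s = foldl (@comm_br R B) Theta s.
Proof. by case: s => //= z s /andP[lz _] _; rewrite is_letterP. Qed.

Lemma horner_endo_eigen (T : endo (oner_neq0 B)) (p : {poly R}) c b :
  T b = c *: b -> horner_alg T p b = p.[c] *: b.
Proof.
move=> Tb; elim/poly_ind: p => [|p a IHp]; first by rewrite rmorph0 horner0 scale0r.
have -> : horner_alg T (p * 'X + a%:P) = horner_alg T p * T + a%:A.
  by rewrite rmorphD rmorphM /= horner_algX horner_algC.
by rewrite endoDE endoME Tb linearZ endoZE endo1E /= IHp hornerMXaddC scalerA mulrC -scalerDl.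
Qed.

(* [prod_j ('X - j)] evaluated at [D] kills all words of positive length, but
   acts as a nonzero scalar on the kernel of [D]. *)
Lemma D_inj b : word_span 1 b -> D b = 0 -> b = 0.
Proof.
move=> [I /allP hI bE] Db; pose T := - adr Theta.
have TE a : T a = D a by rewrite comm_brE.
pose p : {poly R} := \prod_(1 <= j < N.+1) ('X - j%:R%:P).
have pb : horner_alg T p b = p.[0] *: b.
  by apply: horner_endo_eigen; rewrite TE Db scale0r.
have p0 : p.[0] != 0.
  rewrite horner_prod big_seq prodf_seq_neq0; apply/allP => j.
  rewrite mem_index_iota => /andP[j1 _]; apply/implyP => _.
  by rewrite hornerXsubC sub0r oppr_eq0 pnatr_eq0 -lt0n.
suff : p.[0] *: b = 0 by move/eqP; rewrite scaler_eq0 (negPf p0) => /eqP.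
rewrite -pb bE linear_sum /= big_seq big1 // => i iI.
have /andP[li si] := hI _ iI; rewrite linearZ /=.
rewrite (@horner_endo_eigen _ _ (size i.2)%:R) ?TE ?D_word //.
have [Ni|iN] := leqP N.+1 (size i.2).
  by rewrite long_word0 ?scaler0 // ltnW.
rewrite horner_prod (big_rem (size i.2)) ?mem_index_iota ?si //=.
by rewrite hornerXsubC subrr mul0r scale0r scaler0.
Qed.

Let W := aexp N X * aexp N Y.
(** [adr z] is a difference of two commuting operators of nilpotency order N, hence the truncation
    2N. [C] below is the conjugation of v into W^-1 v W. *)
Let K := (N + N)%N.
Let C := aexp K (adr Y) * aexp K (adr X).
Let Z0 := alog N (W - 1).

Hypothesis N_gt0 : (0 < N)%N.

Let X_nil : X ^+ N = 0.
Proof. by apply: word_span_nil; apply: word_span_letter; rewrite /is_letter eqxx. Qed.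
Let Y_nil : Y ^+ N = 0.
Proof. by apply: word_span_nil; apply: word_span_letter; rewrite /is_letter eqxx orbT. Qed.

Let aexp_span z : is_letter z -> word_span 1 (aexp N z - 1).
Proof.
move=> lz; rewrite aexpE -(prednK N_gt0) big_ord_recl /= fact0 invr1 scale1r expr0.
rewrite addrAC subrr add0r; apply: word_span_sum => i _ _; apply: word_spanZ.
rewrite exprS -[1%N]addn0; apply: word_spanM; first exact: word_span_letter.
by have := word_spanX i (word_spanW (leq0n 1) (word_span_letter lz)); rewrite mul0n.
Qed.

Let W_span : word_span 1 (W - 1).
Proof.
have hX : word_span 1 (aexp N X - 1) by apply: aexp_span; rewrite /is_letter eqxx.
have hY : word_span 1 (aexp N Y - 1).
  by apply: aexp_span; rewrite /is_letter eqxx orbT.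
rewrite (_ : W - 1 = (aexp N X - 1) * (aexp N Y - 1) +
    (aexp N X - 1) + (aexp N Y - 1)); last first.
  rewrite mulrBr mulr1 subrK /W mulrBl mul1r addrA subrK //.
have hXY := word_spanW (isT : (1 <= 1 + 1)%N) (word_spanM hX hY).
exact: word_spanD (word_spanD hXY hX) hY.
Qed.

Let W_nil : (W - 1) ^+ N = 0. Proof. exact: word_span_nil. Qed.

Let Z0_span : word_span 1 Z0.
Proof.
rewrite /Z0 alogE; apply: word_span_sum => -[[|i] iN] _ _ /=.
  by rewrite invr0 mulr0 scale0r; apply: word_span0.
apply/word_spanZ/(@word_spanW _ (1 * i.+1)); first by rewrite mul1n.
exact: word_spanX.
Qed.

Let aexpZ0 : aexp N Z0 = W.
Proof. by rewrite aexp_log // addrC subrK. Qed.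

Let C_Z0 : C = aexp K (adr Z0).
Proof.
have Z0_nil := word_span_nil Z0_span.
have inv : aexp N (- Z0) = aexp N (- Y) * aexp N (- X).
  rewrite -[LHS]mulr1 -[X in _ * X](_ : aexp N Z0 * (aexp N (- Y) * aexp N (- X)) = _).
    by rewrite mulrA aexpN // mul1r.
  rewrite aexpZ0 /W mulrA -[_ * _ * aexp N (- Y)]mulrA.
  have -> : aexp N Y * aexp N (- Y) = 1.
    by rewrite -{1}[Y]opprK aexpN // exprNn Y_nil mulr0.
  by rewrite mulr1 -{1}[X]opprK aexpN // exprNn X_nil mulr0.
apply: endoP => v; rewrite endoME !aexp_adr // inv aexpZ0 /W !mulrA //.
Qed.

(** Conjugation by W = exp Z0 is the exponential of [adr Z0]; taking logarithms and applying them to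
    [Theta] leaves [Theta, Z0]. *)
Let logC : alog K (C - 1) Theta = D Z0.
Proof. by rewrite C_Z0 alogK ?adrE //; apply/adr_nil/word_span_nil. Qed.

Lemma bch_log : exists Z : B, [/\ word_span 1 Z,
  aexp N Z = aexp N X * aexp N Y &
  alog (N + N) (aexp (N + N) (adr Y) * aexp (N + N) (adr X) - 1) Theta = D Z].
Proof. by exists Z0; split. Qed.

End DynkinFormula.

Section DynkinOperators.
Variables (R : numFieldType) (B : algType R) (X Y : B).
Implicit Types (w s : seq B) (k m n : nat).

Local Notation E := (endo (oner_neq0 B)).
Local Notation I2 m := ('I_m * 'I_m)%type.

Fixpoint fold_adr s : E := if s is z :: s' then fold_adr s' * adr z else 1.

Lemma fold_adrE s v : fold_adr s v = foldl (@comm_br R B) v s.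
Proof. by elim: s v => [//|z s IHs] v /=; rewrite IHs. Qed.

Lemma fold_adr_cat s1 s2 : fold_adr (s1 ++ s2) = fold_adr s2 * fold_adr s1.
Proof.
by elim: s1 => [|z s1 IHs] /=; rewrite ?mulr1 // IHs mulrA.
Qed.

Lemma fold_adr_nseq n z : fold_adr (nseq n z) = adr z ^+ n.
Proof. by elim: n => [//|n IHn] /=; rewrite IHn exprSr. Qed.

Definition block_word m (t : I2 m) : seq B := nseq t.1 X ++ nseq t.2 Y.
Definition block_deg m (t : I2 m) : nat := t.1 + t.2.
Definition block_fact m (t : I2 m) : nat := t.1`! * t.2`!.
Definition block_op m (t : I2 m) : E :=
  (block_fact t)%:R^-1 *: (adr Y ^+ t.2 * adr X ^+ t.1).

Definition blocks_neq0 m (l : seq (I2 m)) := all (fun t => 0 < block_deg t)%N l.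
Definition blocks_deg m (l : seq (I2 m)) : nat := \sum_(t <- l) block_deg t.
Definition blocks_op m (l : seq (I2 m)) : E :=
  (\prod_(t <- l) block_fact t)%:R^-1 *: fold_adr (flatten (map (@block_word m) l)).

(* The part of degree [j] of [(aexp Y * aexp X - 1) ^+ n], where [aexp X] and
   [aexp Y] act by right brackets. *)
Definition dynkin_op m n j : E := sum_lists n (fun l : seq (I2 m) =>
  if blocks_neq0 l && (blocks_deg l == j) then blocks_op l else 0).

Lemma fold_adr_block m (t : I2 m) :
  fold_adr (block_word t) = adr Y ^+ t.2 * adr X ^+ t.1.
Proof. by rewrite fold_adr_cat !fold_adr_nseq. Qed.

Lemma blocks_op_cons m (t : I2 m) l :
  blocks_op (t :: l) = blocks_op l * block_op t.
Proof.
rewrite /blocks_op big_cons /= fold_adr_cat fold_adr_block natrM invfM.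
by rewrite /block_op -scalerAr -scalerAl scalerA.
Qed.

Lemma blocks_op_nil m : blocks_op ([::] : seq (I2 m)) = 1.
Proof. by rewrite /blocks_op big_nil invr1 scale1r. Qed.

Lemma letters_block_words m (l : seq (I2 m)) :
  all (is_letter X Y) (flatten (map (@block_word m) l)).
Proof.
apply/allP => z /flattenP [s /mapP[t _ ->]]; rewrite mem_cat /is_letter.
by case/orP => /nseqP [-> _]; rewrite eqxx ?orbT.
Qed.

Lemma size_block_words m (l : seq (I2 m)) :
  size (flatten (map (@block_word m) l)) = blocks_deg l.
Proof.
rewrite size_flatten /shape -map_comp sumnE big_map.
by apply: eq_bigr => t _; rewrite /= size_cat !size_nseq.
Qed.

Lemma dynkin_op0 m j : dynkin_op m 0 j = (j == 0%N)%:R.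
Proof.
by rewrite /dynkin_op /= blocks_op_nil /blocks_deg big_nil eq_sym; case: eqP.
Qed.

Lemma dynkin_opS m n j : dynkin_op m n.+1 j =
  \sum_(t : I2 m | (0 < block_deg t <= j)%N)
    dynkin_op m n (j - block_deg t)%N * block_op t.
Proof.
rewrite /dynkin_op /= [RHS]big_mkcond /=; apply: eq_bigr => t _.
case: ifP => [/andP[t0 tj]|tj]; last first.
  apply: sum_lists0 => l _; case: ifP => // /andP[/= /andP[t0 _] /eqP].
  by rewrite /blocks_deg big_cons => degj; move: tj; rewrite t0 -degj leq_addr.
rewrite (morph_sum_lists (f := *%R^~ (block_op t))) ?mul0r //; last first.
  by move=> a b; rewrite mulrDl.
apply: eq_sum_lists => l _; rewrite /= t0 /= /blocks_deg big_cons.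
rewrite -[in RHS](eqn_add2l (block_deg t)) subnKC //.
by case: ifP => _; rewrite ?blocks_op_cons ?mul0r.
Qed.

(** [bch_term] bounds the exponents by the degree, the exponentials bound them by a common
    truncation. In degree j no exponent exceeds j, so the two bounds select the same terms. *)
Lemma dynkin_op_cutoff m n j : (j < m)%N -> dynkin_op m n j = dynkin_op j.+1 n j.
Proof.
elim: n m j => [|n IHn] m j jm; first by rewrite !dynkin_op0.
pose F p q := dynkin_op j.+1 n (j - (p + q))%N *
  ((p`! * q`!)%:R^-1 *: (adr Y ^+ q * adr X ^+ p)).
have FE k : (j < k)%N -> dynkin_op k n.+1 j =
    \sum_(p < k) \sum_(q < k | (0 < p + q <= j)%N) F p q.
  move=> jk; rewrite dynkin_opS pair_big_dep /=; apply: eq_bigr => t /andP[t0 tj].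
  rewrite /F /block_op IHn ?(leq_ltn_trans (leq_subr _ _) jk) //.
  by rewrite [in RHS]IHn ?ltnS ?leq_subr.
rewrite !FE //; apply/esym.
rewrite (big_ord_widen_cond m xpredT
  (fun p => \sum_(q < j.+1 | (0 < p + q <= j)%N) F p q)) //= big_mkcond /=.
apply: eq_bigr => p _; case: ifP => [pj|jp]; last first.
  by rewrite big_pred0 // => q; apply/negbTE; move: jp; lia.
rewrite (big_ord_widen_cond m (fun q => 0 < p + q <= j)%N (F p)) //.
by apply: eq_bigl => q; lia.
Qed.

Lemma dynkin_op_vanish m n j : (j < n)%N -> dynkin_op m n j = 0.
Proof.
move=> jn; apply: sum_lists0 => l ln; case: ifP => // /andP[nz /eqP degj].
suff : (size l <= blocks_deg l)%N by rewrite ln degj leqNgt jn.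
elim: l nz {ln degj} => [//|t l IHl] /= /andP[t0 nz].
by rewrite /blocks_deg big_cons -add1n leq_add //; apply: IHl.
Qed.

Lemma aexp_blocks m : (0 < m)%N -> aexp m (adr Y) * aexp m (adr X) - 1 =
  \sum_(t : I2 m | (0 < block_deg t)%N) block_op t.
Proof.
case: m => // m _.
have -> : aexp m.+1 (adr Y) * aexp m.+1 (adr X) = \sum_(t : I2 m.+1) block_op t.
  rewrite !aexpE big_distrlr exchange_big pair_bigA /=; apply: eq_bigr => t _.
  rewrite -scalerAl -scalerAr scalerA /block_op /block_fact natrM invfM.
  by rewrite [X in X *: _]mulrC.
rewrite (bigD1 (ord0, ord0)) //= {1}/block_op /block_fact /= !expr0 mulr1.
rewrite mul1n fact0 invr1 scale1r addrAC subrr add0r; apply: eq_bigl => t.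
by rewrite -pair_eqE /= negb_and -!lt0n addn_gt0.
Qed.

Lemma aexp_blocksX m n : (0 < m)%N ->
  (aexp m (adr Y) * aexp m (adr X) - 1) ^+ n =
  \sum_(j < (n * (m + m)).+1) dynkin_op m n j.
Proof.
move=> m0; transitivity (sum_lists n (fun l : seq (I2 m) =>
    if blocks_neq0 l then blocks_op l else 0)).
  elim: n => [|n IHn] /=; first by rewrite blocks_op_nil.
  rewrite exprSr {}IHn aexp_blocks // mulr_sumr big_mkcond; apply: eq_bigr => t _.
  case: ifP => [t0|_]; last by rewrite sum_lists0.
  rewrite (morph_sum_lists (f := *%R^~ (block_op t))) ?mul0r //; last first.
    by move=> a b; rewrite mulrDl.
  apply: eq_sum_lists => l _ /=.
  by case: ifP => _; rewrite ?blocks_op_cons ?mul0r.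
rewrite /dynkin_op -sum_lists_sum; apply: eq_sum_lists => l ln.
case: ifP => _ /=; last by rewrite big1.
have lt_deg : (blocks_deg l < (n * (m + m)).+1)%N.
  rewrite ltnS -ln /blocks_deg; elim: l {ln} => [|t l IHl]; first by rewrite big_nil.
  by rewrite big_cons mulSn leq_add // /block_deg leq_add // ltnW.
rewrite -big_mkcond (big_pred1 (Ordinal lt_deg)) //.
Qed.

(** The factor m cancels the 1/m in Dynkin's coefficient, and each nested bracket, started at
    [Theta], is the value of [fold_adr] on its word. *)
Lemma bch_commE Theta m :
    comm_br Theta X = X -> comm_br Theta Y = Y -> (0 < m)%N ->
  m%:R *: bch_comm m X Y =
  \sum_(1 <= n < m.+1) ((-1) ^+ n.-1 / n%:R : R) *: dynkin_op m.+1 n m Theta.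
Proof.
move=> ThX ThY m0; rewrite scaler_sumr big_nat [RHS]big_nat.
apply: eq_bigr => n /andP[n0 _].
pose G (l : seq (I2 m.+1)) : B :=
  ((-1) ^+ n.-1 / (n * m * \prod_(t <- l) block_fact t)%:R : R) *:
    nested_comm (flatten (map (@block_word m.+1) l)).
pose P (l : seq (I2 m.+1)) := blocks_neq0 l && (blocks_deg l == m).
rewrite (eq_big (fun pq : {ffun 'I_n -> I2 m.+1} => P [seq pq i | i <- enum 'I_n])
  (fun pq => G [seq pq i | i <- enum 'I_n])); first last.
- move=> pq _; rewrite /G big_map big_enum -map_comp //.
- move=> pq; rewrite /P /blocks_neq0 all_map /blocks_deg big_map big_enum /=.
  by congr (_ && _); apply/forallP/allP => [h i _|h i]; [apply: h|apply: h; rewrite mem_enum].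
rewrite (sum_ffunE n P G) (morph_sum_lists (f := fun e : E => e Theta)) //.
rewrite !(morph_sum_lists (f := *:%R _)) ?scaler0 //; try by move=> a b; rewrite scalerDr.
apply: eq_sum_lists => l ln; rewrite -/(P l); case: ifP => [/andP[nz /eqP degl]|_]; last first.
  by rewrite !scaler0.
have lw := letters_block_words l; have sw := size_block_words l; rewrite degl in sw.
rewrite /G (nested_foldl ThX ThY) ?sw // /blocks_op endoZE fold_adrE !scalerA.
congr (_ *: _); rewrite !natrM !invfM.
have : m%:R != 0 :> R by rewrite pnatr_eq0 -lt0n.
by move: n%:R^-1 ((\prod_(t <- l) _)%:R^-1) => a b m_neq0; field.
Qed.

End DynkinOperators.

Section BakerCampbellHausdorff.
Variables (R : numFieldType) (B : algType R) (X Y Theta : B) (N : nat).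
Hypothesis ThetaX : comm_br Theta X = X.
Hypothesis ThetaY : comm_br Theta Y = Y.
Hypothesis nilXY : forall w : seq B,
  all (is_letter X Y) w -> size w = N -> \prod_(z <- w) z = 0.
Hypothesis N_gt0 : (0 < N)%N.

Lemma bch_word n m (pq : {ffun 'I_n -> 'I_m * 'I_m})
    (w := flatten [seq nseq (pq i).1 X ++ nseq (pq i).2 Y | i <- enum 'I_n]) :
  all (is_letter X Y) w /\ size w = (\sum_i ((pq i).1 + (pq i).2))%N.
Proof.
rewrite {}/w (_ : flatten _ = flatten (map (@block_word _ _ X Y m) [seq pq i | i <- enum 'I_n])).
  rewrite letters_block_words size_block_words /blocks_deg big_map big_enum.
  by split.
by rewrite -map_comp.
Qed.

Lemma word_span_bch m : word_span X Y m (bch_comm m X Y).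
Proof.
apply: word_span_sum => n _ _; apply: word_span_sum => pq _ /andP[_ /eqP degm].
have [lw sw] := bch_word pq; apply/word_spanZ/word_spanW/(word_span_nested lw).
by rewrite sw degm.
Qed.

Lemma D_bch m : comm_br Theta (bch_comm m X Y) = m%:R *: bch_comm m X Y.
Proof.
have [T TE] := comm_br_endo Theta.
rewrite TE /bch_comm linear_sum scaler_sumr; apply: eq_bigr => n _.
rewrite linear_sum scaler_sumr; apply: eq_bigr => pq /andP[_ /eqP degm].
have [lw sw] := bch_word pq; rewrite degm in sw.
by rewrite linearZ /= -TE (D_nested ThetaX ThetaY lw) sw !scalerA mulrC.
Qed.

Lemma dynkin_op_nil m n j : (N <= j)%N -> dynkin_op X Y m n j Theta = 0.
Proof.
move=> Nj; rewrite (morph_sum_lists (f := fun e : endo (oner_neq0 B) => e Theta)) //.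
apply: sum_lists0 => l ln; case: ifP => // /andP[nz /eqP degl].
have lw := letters_block_words X Y l; have sw := size_block_words X Y l; rewrite degl in sw.
rewrite /blocks_op endoZE fold_adrE -(nested_foldl ThetaX ThetaY) //; last first.
  by rewrite sw (leq_trans N_gt0).
rewrite (word_spanN nilXY (word_spanW _ (word_span_nested lw))) ?sw //.
by rewrite scaler0.
Qed.

(* As [Theta] satisfies [[Theta, X] = X] and [[Theta, Y] = Y], acting by right
   brackets on [Theta] turns [m] times the [m]-th Dynkin term into the part of
   degree [m] of [log (exp Y exp X)], which maps [Theta] to [[Theta, Z]] for
   [Z = log (exp X exp Y)]. *)
Theorem bch_aexp :
  aexp N (\sum_(1 <= m < N) bch_comm m X Y) = aexp N X * aexp N Y.
Proof.
have [Z [Z_span <- logC]] := bch_log Theta nilXY N_gt0; congr (aexp N).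
apply/eqP; rewrite -subr_eq0; apply/eqP; apply: (D_inj ThetaX ThetaY nilXY).
  apply: word_spanB Z_span; rewrite big_nat; apply: word_span_sum => m _ /andP[m1 _].
  exact: word_spanW m1 (word_span_bch m).
have [T TE] := comm_br_endo Theta.
rewrite comm_brB -{}logC alogE endo_sumE TE linear_sum.
set K := (N + N)%N; have K0 : (0 < K)%N by rewrite addn_gt0 N_gt0.
set a := fun n : nat => (-1) ^+ n.-1 / n%:R : R.
apply/eqP; rewrite subr_eq0; apply/eqP.
(* Both sides are double sums over the degree j and the number n of blocks. In degree j at most j
   blocks occur, as each has positive degree; for n = 0 the coefficient [a 0] is zero. *)
transitivity (\sum_(1 <= j < N) \sum_(n < K) a n *: dynkin_op X Y K n j Theta).
  apply: eq_big_nat => j /andP[j1 jN].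
  rewrite -[LHS]/(T _) -TE D_bch (bch_commE ThetaX ThetaY j1).
  rewrite -(big_mkord xpredT (fun n => a n *: dynkin_op X Y K n j Theta)).
  have jK : (j < K)%N by rewrite (leq_trans jN) // leq_addr.
  rewrite [RHS]big_ltn // {1}/a invr0 mulr0 scale0r add0r.
  rewrite [RHS](@big_cat_nat _ _ _ j.+1) //= [X in _ = _ + X]big_nat_cond.
  rewrite [X in _ = _ + X]big1 ?addr0; last first.
    by move=> n /andP[/andP[jn _] _]; rewrite dynkin_op_vanish // endo0E scaler0.
  by apply: eq_bigr => n _; rewrite (dynkin_op_cutoff _ _ _ jK).
rewrite exchange_big; apply: eq_bigr => -[[|n] nK] _.
  by rewrite endoZE big1 /a ?invr0 ?mulr0 ?scale0r // => j _; rewrite scale0r.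
rewrite endoZE [nat_of_ord _]/= aexp_blocksX // endo_sumE -scaler_sumr; congr (_ *: _).
(* The power n + 1 has no part of degree 0, and its parts of degree at least N kill [Theta], so the
   range of j may be completed to all degrees. *)
rewrite -(big_mkord xpredT (fun j => dynkin_op X Y K n.+1 j Theta)).
rewrite [RHS]big_ltn // dynkin_op_vanish // endo0E add0r.
rewrite [RHS](@big_cat_nat _ _ _ N) //=; last by lia.
rewrite [X in _ = _ + X]big_nat_cond [X in _ = _ + X]big1 ?addr0 //.
by move=> j /andP[/andP[Nj _] _]; apply: dynkin_op_nil.
Qed.

End BakerCampbellHausdorff.

(** * Graded Lie algebras *)

Section Bracket.
Variables (R : realType) (L : banach_lie_algebra R).
Implicit Types (x y z : L) (a : R).

Lemma bracketDl x y z : bracket (x + y) z = bracket x z + bracket y z.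
Proof. by have := bracket_linearl z 1 x y; rewrite !scale1r. Qed.

Lemma bracketDr x y z : bracket z (x + y) = bracket z x + bracket z y.
Proof. by have := bracket_linearr z 1 x y; rewrite !scale1r. Qed.

Lemma bracket0l x : bracket 0 x = 0.
Proof. by apply: (@addrI _ (bracket 0 x)); rewrite -bracketDl !addr0. Qed.

Lemma bracket0r x : bracket x 0 = 0.
Proof. by rewrite bracket_skew bracket0l oppr0. Qed.

Lemma bracketZl a x y : bracket (a *: x) y = a *: bracket x y.
Proof. by have := bracket_linearl y a x 0; rewrite bracket0l !addr0. Qed.

Lemma bracketZr a x y : bracket x (a *: y) = a *: bracket x y.
Proof. by have := bracket_linearr x a y 0; rewrite bracket0r !addr0. Qed.

Lemma bracketNr x y : bracket x (- y) = - bracket x y.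
Proof. by rewrite -scaleN1r bracketZr scaleN1r. Qed.

Lemma bracket_suml (I : Type) (r : seq I) (P : pred I) (F : I -> L) y :
  bracket (\sum_(i <- r | P i) F i) y = \sum_(i <- r | P i) bracket (F i) y.
Proof.
by elim/big_rec2: _ => [|i a b _ <-]; rewrite ?bracket0l ?bracketDl.
Qed.

Lemma bracket_sumr (I : Type) (r : seq I) (P : pred I) (F : I -> L) y :
  bracket y (\sum_(i <- r | P i) F i) = \sum_(i <- r | P i) bracket y (F i).
Proof.
by elim/big_rec2: _ => [|i a b _ <-]; rewrite ?bracket0r ?bracketDr.
Qed.

(** Nilpotency is stated for left-nested brackets, whereas products of adjoint operators produce
    right-nested ones. *)
Lemma foldr_bracket s x :
  foldr (@bracket R L) x s = (-1) ^+ size s *: foldl (@bracket R L) x (rev s).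
Proof.
elim: s => [|y s IHs] /=; first by rewrite scale1r.
by rewrite IHs rev_cons foldl_rcons bracketZr bracket_skew exprS mulN1r scalerN scaleNr.
Qed.

End Bracket.

Section Subspace.
Variables (R : realType) (V : lmodType R) (S : set V).
Hypothesis sS : is_subspace S.

Lemma subspaceZ a x : S x -> S (a *: x).
Proof. by move=> Sx; rewrite -[_ *: _]addr0; apply: sS.2 Sx sS.1. Qed.

Lemma subspaceD x y : S x -> S y -> S (x + y).
Proof. by move=> Sx Sy; rewrite -[x]scale1r; apply: sS.2. Qed.

Lemma subspace_sum (I : Type) (r : seq I) (P : pred I) (F : I -> V) :
  (forall i, P i -> S (F i)) -> S (\sum_(i <- r | P i) F i).
Proof. by move=> SF; apply: big_ind SF => //; [exact: sS.1|exact: subspaceD]. Qed.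

End Subspace.

Section Layers.
Variables (R : realType) (M : banach_homogeneous_group R).
Implicit Types (x y z : M) (a r : R) (c : nat -> R).
Local Notation nu := (step M).
Local Notation pr := (@layer_proj R M).

Lemma layer_subspaceS (i : 'I_nu) : is_subspace (layer M i.+1).
Proof. by apply: layer_subspace; rewrite /= ltn_ord. Qed.

Lemma layer_proj_layer (i : 'I_nu) x : layer M i.+1 (pr i x).
Proof.
have [+ _ _] := bijpinv_bij (fun=> fun=> 0) (layer_direct_sum M).
by move/(_ x I); apply.
Qed.

Lemma layer_proj_sum x : \sum_i pr i x = x.
Proof.
have [_ _ surj] := layer_direct_sum M.
by apply: (surjpK (fun=> fun=> 0) surj); rewrite inE.
Qed.

Lemma layer_proj_uniq (h : 'I_nu -> M) i :
  (forall j : 'I_nu, layer M j.+1 (h j)) -> pr i (\sum_j h j) = h i.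
Proof.
move=> hl; have [_ inj _] := layer_direct_sum M.
rewrite -[RHS](_ : (fun j => pr j (\sum_j h j)) i = _) //; congr (_ i).
apply: inj; rewrite ?inE //= ?layer_proj_sum //.
by move=> j; apply: layer_proj_layer.
Qed.

Lemma layer_proj_linear i : linear (pr i).
Proof.
move=> a x y; rewrite -{1}[x]layer_proj_sum -{1}[y]layer_proj_sum.
rewrite scaler_sumr -big_split layer_proj_uniq // => j.
by apply: (layer_subspaceS j).2; apply: layer_proj_layer.
Qed.

HB.instance Definition _ i :=
  GRing.isLinear.Build R M M _ (pr i) (@layer_proj_linear i).

Lemma layer_proj_id (i j : 'I_nu) x :
  layer M i.+1 x -> pr j x = if j == i then x else 0.
Proof.
move=> lx; rewrite -{1}[x](_ : \sum_k (if k == i then x else 0) = _).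
  rewrite layer_proj_uniq // => k; case: eqP => [->//|_].
  exact: (layer_subspaceS k).1.
by rewrite -big_mkcond big_pred1_eq.
Qed.

Lemma layer_proj_inj x y : (forall i, pr i x = pr i y) -> x = y.
Proof.
by move=> xy; rewrite -[x]layer_proj_sum -[y]layer_proj_sum; apply: eq_bigr.
Qed.

(** Projection i belongs to layer i + 1, so the degree condition (j + 1) + (k + 1) = i + 1 reads j +
    k + 1 = i. *)
Lemma layer_proj_bracket i x y : pr i (bracket x y) =
  \sum_(jk : 'I_nu * 'I_nu | (jk.1 + jk.2).+1 == i) bracket (pr jk.1 x) (pr jk.2 y).
Proof.
pose F (jk : 'I_nu * 'I_nu) := bracket (pr jk.1 x) (pr jk.2 y).
have -> : bracket x y =
    \sum_(k : 'I_nu) \sum_(jk : 'I_nu * 'I_nu | (jk.1 + jk.2).+1 == k) F jk.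
  rewrite -{1}[x]layer_proj_sum -{1}[y]layer_proj_sum bracket_suml.
  under eq_bigr do rewrite bracket_sumr.
  rewrite pair_bigA /= -/(F _) (exchange_big_dep xpredT) //=; apply: eq_bigr => -[j k] _ /=.
  have [lt|ge] := ltnP (j + k).+1 nu.
    by rewrite (big_pred1 (Ordinal lt)).
  rewrite big_pred0 => [|l]; last by rewrite gtn_eqF // (leq_trans _ ge).
  apply: (@layer_bracket0 R M j.+1 k.+1); rewrite /= ?ltn_ord ?addnS ?addSn //.
  - exact: layer_proj_layer.
  - exact: layer_proj_layer.
rewrite layer_proj_uniq // => k; apply: (subspace_sum (layer_subspaceS k)).
move=> jk /eqP kE; rewrite -kE -addnS -addSn.
apply: layer_bracket; rewrite ?addnS ?addSn ?kE ?ltn_ord //.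
- exact: layer_proj_layer.
- exact: layer_proj_layer.
Qed.

Definition weight_map c x : M := \sum_(i < nu) c i *: pr i x.

Lemma layer_proj_weight c i x : pr i (weight_map c x) = c i *: pr i x.
Proof.
rewrite layer_proj_uniq // => j.
by apply: (subspaceZ (layer_subspaceS j)); apply: layer_proj_layer.
Qed.

Lemma weight_map_linear c : linear (weight_map c).
Proof.
move=> a x y; apply: layer_proj_inj => i.
by rewrite linearP /= !layer_proj_weight linearP /= scalerDr !scalerA mulrC.
Qed.

HB.instance Definition _ c :=
  GRing.isLinear.Build R M M _ (weight_map c) (@weight_map_linear c).

Lemma dilationE r : dilation r = weight_map (fun i => r ^+ i.+1) :> (M -> M).
Proof. by []. Qed.

Lemma dilation_bracket r x y :
  dilation r (bracket x y) = bracket (dilation r x : M) (dilation r y : M) :> M.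
Proof.
apply: layer_proj_inj => i; rewrite dilationE layer_proj_weight !layer_proj_bracket.
rewrite scaler_sumr; apply: eq_bigr => jk /eqP <-.
rewrite !layer_proj_weight bracketZl bracketZr scalerA; congr (_ *: _).
by rewrite -exprD addnS addSn.
Qed.

(** The derivative of the dilations at r = 1, hence a derivation; it is injective, unlike the inner
    derivations. *)
Definition degree_map := weight_map (fun i => i.+1%:R).

HB.instance Definition _ :=
  GRing.isLinear.Build R M M _ degree_map (@weight_map_linear _).

Lemma degree_map_bracket x y : degree_map (bracket x y) =
  bracket (degree_map x) y + bracket x (degree_map y).
Proof.
apply: layer_proj_inj => i.
rewrite linearD /= layer_proj_weight !layer_proj_bracket scaler_sumr -big_split.
apply: eq_bigr => jk /eqP <- /=.
rewrite !layer_proj_weight bracketZl bracketZr -scalerDl; congr (_ *: _).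
by rewrite -natrD addnS addSn.
Qed.

Lemma degree_map_inj x : degree_map x = 0 -> x = 0.
Proof.
move=> x0; apply: layer_proj_inj => i; rewrite linear0.
have := congr1 (pr i) x0; rewrite layer_proj_weight linear0 => /eqP.
by rewrite scaler_eq0 pnatr_eq0 => /eqP.
Qed.

Lemma step_gt0 : (0 < nu)%N.
Proof.
by have [_ [s [ss]]] := step_nilpotent M; case: posnP ss => // -> /size0nil ->.
Qed.

Lemma foldr_bracket_nil s x : size s = nu -> foldr (@bracket R M) x s = 0.
Proof.
move=> ss; rewrite foldr_bracket.
have := (step_nilpotent M).1 (x :: rev s); rewrite /= size_rev ss => -> //.
by rewrite scaler0.
Qed.

End Layers.

(** * Associativity of the Baker-Campbell-Hausdorff product *)

Section GroupRepresentation.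
Variables (R : realType) (M : banach_homogeneous_group R).
Implicit Types (x y z : M) (v : M * R^o).
Local Notation N := (step M).+1.

Fact vec_neq0 : ((0, 1) : M * R^o) != 0.
Proof. by rewrite -pair_eqE /= oner_eq0 andbF. Qed.

Local Notation A := (endo vec_neq0).

Fact rep_linear x :
  linear (fun v : M * R^o => (bracket x v.1 + v.2 *: degree_map x, 0) : M * R^o).
Proof.
move=> a u v; congr pair => /=; last by rewrite scaler0 addr0.
by rewrite bracketDr bracketZr scalerDl scalerDr scalerA addrACA.
Qed.

(* The adjoint representation of the extension of [M] by its degree
   derivation; the extension makes it faithful on [M]. *)
Definition rep x : A := Endo _ (@rep_linear x).

Fact rep_is_linear : linear rep.
Proof.
move=> a x y; apply: endoP => v; congr pair => /=; last by rewrite scaler0 addr0.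
by rewrite bracketDl bracketZl linearP /= !scalerDr !scalerA [a * _]mulrC addrACA.
Qed.

HB.instance Definition _ := GRing.isLinear.Build R M A _ rep rep_is_linear.

Lemma rep_bracket x y : rep (bracket x y) = comm_br (rep x) (rep y).
Proof.
apply: endoP => -[v s]; congr pair => /=; last by rewrite subrr.
rewrite !scale0r !addr0 degree_map_bracket !bracketDr !bracketZr scalerDr.
have -> : bracket (bracket x y) v = bracket x (bracket y v) - bracket y (bracket x v).
  have /eqP := bracket_jacobi x y v; rewrite addr_eq0 => /eqP J.
  by rewrite bracket_skew -J [bracket v x]bracket_skew bracketNr.
by rewrite [bracket _ y]bracket_skew scalerN [- _ + _]addrC addrACA opprD.
Qed.

(** The vector (0, 1) stands for the degree derivation and is sent to [degree_map x]. The adjoint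
    action on M alone would lose the centre. *)
Lemma rep_inj x y : rep x = rep y -> x = y.
Proof.
move/eqP; rewrite -subr_eq0 -linearB => /eqP /(congr1 (fun f : A => (f (0, 1)).1)).
rewrite /= bracket0r add0r scale1r => /degree_map_inj /eqP.
by rewrite subr_eq0 => /eqP.
Qed.

Lemma rep_prod s x v : (\prod_(z <- map rep (rcons s x)) z) v =
  (foldr (@bracket R M) (rep x v).1 s, 0).
Proof.
elim: s => [|y s IHs]; first by rewrite /= big_seq1.
by rewrite /= big_cons endoME IHs /= scale0r addr0.
Qed.

(** The factor applied first maps into M, and the remaining [step M] factors act there as brackets;
    this explains the order N = step + 1. *)
Lemma rep_prod0 s : size s = N -> \prod_(z <- map rep s) z = 0.
Proof.
case/lastP: s => [//|s x]; rewrite size_rcons => -[ss].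
by apply: endoP => v; rewrite rep_prod foldr_bracket_nil.
Qed.

Lemma rep_nil x : rep x ^+ N = 0.
Proof.
rewrite -(rep_prod0 (size_nseq N x)) map_nseq.
by elim: N => [|n IHn]; rewrite ?big_nil // big_cons exprS IHn.
Qed.

Fact seq_vec_neq0 : ((fun=> (0, 1)) : nat -> (M * R^o)%type) != 0.
Proof. by apply: contra_neq vec_neq0 => /(congr1 (fun h => h 0%N)). Qed.

Local Notation B := (endo seq_vec_neq0).

Fact shift_linear (f : A) : linear (fun (h : nat -> (M * R^o)%type) i => f (h i.+1)).
Proof. by move=> a h k; apply/funext => i /=; rewrite linearP. Qed.

(* [f * t], where multiplication by the formal parameter [t] is the backward
   shift; constant sequences are the evaluation at [t = 1], and [grading] is
   the Euler derivation of [t]. *)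
Definition shift (f : A) : B := Endo _ (shift_linear f).

Fact grading_linear :
  linear (fun (h : nat -> (M * R^o)%type) i => - (i%:R *: h i)).
Proof.
move=> a h k; apply/funext => i.
change (- (i%:R *: (a *: h i + k i)) = a *: - (i%:R *: h i) - i%:R *: k i).
rewrite scalerDr opprD scalerN.
by rewrite !scalerA mulrC.
Qed.

Definition grading : B := Endo _ grading_linear.

(** The shift reads the entry of index i + 1, so the commutator yields (i + 1) - i = 1; the minus
    sign in [grading] is chosen for this. *)
Lemma grading_shift f : comm_br grading (shift f) = shift f.
Proof.
apply: endoP => h; apply/funext => i; rewrite /comm_br endoDE endoNE !endoME /=.
change (- (i%:R *: f (h i.+1)) - f (- (i.+1%:R *: h i.+1)) = f (h i.+1)).
have -> : f (- (i.+1%:R *: h i.+1)) = - (i.+1%:R *: f (h i.+1)).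
  by rewrite linearN linearZ.
rewrite opprK addrC -scalerBl -natrB //.
by rewrite subSnn scale1r.
Qed.

Lemma shift_prod (s : seq A) h i :
  (\prod_(z <- map shift s) z) h i = (\prod_(z <- s) z) (h (i + size s)%N).
Proof.
elim: s i => [|f s IHs] i; first by rewrite /= !big_nil addn0.
by rewrite /= !big_cons !endoME /= IHs addSnnS.
Qed.

(** Evaluation at t = 1. It is compatible with all operations of the formula, which carries
    identities between shifts back to M. *)
Definition on_constants (f' : B) (f : A) := forall v, f' (fun=> v) = (fun=> f v).

Lemma on_constantsD f' g' f g : on_constants f' f -> on_constants g' g ->
  on_constants (f' + g') (f + g).
Proof. by move=> hf hg v; rewrite endoDE hf hg. Qed.
Lemma on_constantsZ a f' f : on_constants f' f -> on_constants (a *: f') (a *: f).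
Proof. by move=> hf v; rewrite endoZE hf. Qed.
Lemma on_constantsM f' g' f g : on_constants f' f -> on_constants g' g ->
  on_constants (f' * g') (f * g).
Proof. by move=> hf hg v; rewrite endoME hg hf. Qed.
Lemma on_constants_sum (I : Type) (r : seq I) (P : pred I) (F' : I -> B) (F : I -> A) :
  (forall i, P i -> on_constants (F' i) (F i)) ->
  on_constants (\sum_(i <- r | P i) F' i) (\sum_(i <- r | P i) F i).
Proof.
move=> hF; apply: (big_ind2 on_constants) => // f' f g' g.
exact: on_constantsD.
Qed.
Lemma on_constants_shift f : on_constants (shift f) f.
Proof. by []. Qed.
Lemma on_constantsX f' f n : on_constants f' f -> on_constants (f' ^+ n) (f ^+ n).
Proof.
by move=> hf; elim: n => [//|n IHn]; rewrite !exprS; apply: on_constantsM.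
Qed.
Lemma on_constants_aexp n f' f : on_constants f' f -> on_constants (aexp n f') (aexp n f).
Proof.
move=> hf; rewrite !aexpE; apply: on_constants_sum => i _.
exact/on_constantsZ/on_constantsX.
Qed.
Lemma on_constants_comm f' g' f g : on_constants f' f -> on_constants g' g ->
  on_constants (comm_br f' g') (comm_br f g).
Proof.
move=> hf hg; rewrite /comm_br -!(scaleN1r (_ * _)).
by apply: on_constantsD; last apply: on_constantsZ; apply: on_constantsM.
Qed.

Lemma on_constants_nested (s : seq A) :
  on_constants (nested_comm (map shift s)) (nested_comm s).
Proof.
case: s => [//|f s] /=; have := on_constants_shift f.
elim: s f (shift f) => [//|g s IHs] f f' hf /=.
by apply: IHs; apply: on_constants_comm hf (on_constants_shift g).
Qed.

Lemma rep_nested s : rep (nested_bracket s) = nested_comm (map rep s).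
Proof.
case: s => [|x s] /=; first exact: linear0.
by elim: s x => [//|y s IHs] x /=; rewrite IHs rep_bracket.
Qed.

Lemma bch_term_rep m x y : rep (bch_term m x y) = bch_comm m (rep x) (rep y).
Proof.
rewrite linear_sum; apply: eq_bigr => n _; rewrite linear_sum; apply: eq_bigr => pq _.
rewrite linearZ /= rep_nested map_flatten -map_comp; congr (_ *: nested_comm (flatten _)).
by apply: eq_map => i; rewrite /= map_cat !map_nseq.
Qed.

Lemma bch_comm_shift m (f g : A) :
  on_constants (bch_comm m (shift f) (shift g)) (bch_comm m f g).
Proof.
apply: on_constants_sum => n _; apply: on_constants_sum => pq _; apply: on_constantsZ.
have := on_constants_nested
  (flatten [seq nseq (pq i).1 f ++ nseq (pq i).2 g | i <- enum 'I_n]).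
rewrite map_flatten -map_comp.
suff -> : map (map shift \o (fun i => nseq (pq i).1 f ++ nseq (pq i).2 g)) (enum 'I_n) =
  [seq nseq (pq i).1 (shift f) ++ nseq (pq i).2 (shift g) | i <- enum 'I_n] by [].
by apply: eq_map => i; rewrite /= map_cat !map_nseq.
Qed.

(** [gmul] writes its part of degree 1 as x + y; this identifies it with Dynkin's term of degree 1,
    so that the product becomes one uniform sum. *)
Lemma bch_term1 x y : bch_term 1 x y = x + y.
Proof.
rewrite /bch_term big_nat1.
pose P (l : seq ('I_2 * 'I_2)) := blocks_neq0 l && (blocks_deg l == 1%N).
pose G (l : seq ('I_2 * 'I_2)) : M :=
  ((-1) ^+ 0 / (1 * 1 * \prod_(t <- l) block_fact t)%:R : R) *:
  nested_bracket (flatten [seq nseq t.1 x ++ nseq t.2 y | t : 'I_2 * 'I_2 <- l]).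
rewrite (eq_big (fun pq : {ffun 'I_1 -> 'I_2 * 'I_2} => P [seq pq i | i <- enum 'I_1])
  (fun pq => G [seq pq i | i <- enum 'I_1])); first last.
- by move=> pq _; rewrite /G big_map big_enum -map_comp.
- move=> pq; rewrite /P /blocks_neq0 all_map /blocks_deg big_map big_enum /=.
  by congr (_ && _); apply/forallP/allP => [h i _|h i]; [apply: h|apply: h; rewrite mem_enum].
rewrite (sum_ffunE 1 P G) /=.
transitivity (\sum_(i < 2) \sum_(j < 2) if P [:: (i, j)] then G [:: (i, j)] else 0).
  by rewrite pair_bigA; apply: eq_bigr => -[i j].
rewrite !big_ord_recl !big_ord0 /= /P /G /blocks_neq0 /blocks_deg /block_deg.
rewrite /block_fact !big_seq1 /= !addr0 !add0r.
by rewrite !muln1 !invr1 !mulr1 !scale1r addrC.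
Qed.

Lemma gmulE x y : gmul x y = \sum_(1 <= m < N) bch_term m x y.
Proof. by rewrite /gmul -(bch_term1 x y) [RHS]big_ltn // ltnS step_gt0. Qed.

(** [bch_aexp] is applied to the shifts of [rep x] and [rep y], with [grading] as [Theta], and the
    result is evaluated on constant sequences. *)
Lemma rep_gmul x y : aexp N (rep (gmul x y)) = aexp N (rep x) * aexp N (rep y).
Proof.
have nil (w : seq B) : all (is_letter (shift (rep x)) (shift (rep y))) w ->
    size w = N -> \prod_(z <- w) z = 0.
  move=> lw; have [s <-] : exists s, map shift (map rep s) = w.
    elim: w lw => [|z w IHw] /=; first by exists [::].
    by move=> /andP[/orP[] /eqP -> /IHw [s <-]]; [exists (x :: s)|exists (y :: s)].
  rewrite !size_map => ss; apply: endoP => h; apply/funext => i.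
  by rewrite shift_prod rep_prod0.
have E := bch_aexp (grading_shift (rep x)) (grading_shift (rep y)) nil isT.
have -> : rep (gmul x y) = \sum_(1 <= m < N) bch_comm m (rep x) (rep y).
  by rewrite gmulE linear_sum; apply: eq_bigr => m _; apply: bch_term_rep.
apply: endoP => v.
have C1 := on_constants_aexp N (on_constants_sum (index_iota 1 N)
  (fun m (_ : xpredT m) => bch_comm_shift m (rep x) (rep y))) v.
have C2 := on_constantsM (on_constants_aexp N (on_constants_shift (rep x)))
  (on_constants_aexp N (on_constants_shift (rep y))) v.
by move: C1; rewrite E C2 => /(congr1 (fun h => h 0%N)).
Qed.

Lemma gmulA x y z : gmul x (gmul y z) = gmul (gmul x y) z.
Proof.
apply/rep_inj/(aexp_inj (rep_nil _) (rep_nil _)).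
by rewrite !rep_gmul mulrA.
Qed.

Lemma gmul0 x : gmul x 0 = x.
Proof.
apply/rep_inj/(aexp_inj (rep_nil _) (rep_nil _)).
by rewrite rep_gmul linear0 aexp0 mulr1.
Qed.

Lemma gmul0l x : gmul 0 x = x.
Proof.
apply/rep_inj/(aexp_inj (rep_nil _) (rep_nil _)).
by rewrite rep_gmul linear0 aexp0 mul1r.
Qed.

Lemma gmulNx x : gmul (- x) x = 0.
Proof.
apply/rep_inj/(aexp_inj (rep_nil _) (rep_nil _)).
by rewrite rep_gmul linearN aexpN ?rep_nil // linear0 aexp0.
Qed.

Lemma gmulxN x : gmul x (- x) = 0.
Proof. by rewrite -{1}[x]opprK gmulNx. Qed.

Lemma dilation_nested r s :
  dilation r (nested_bracket s) = nested_bracket (map (@dilation R M r) s) :> M.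
Proof.
case: s => [|x s] /=; first by rewrite dilationE linear0.
by elim: s x => [//|y s IHs] x /=; rewrite IHs dilation_bracket.
Qed.

Lemma dilation_gmul r x y : dilation r (gmul x y) = gmul (dilation r x) (dilation r y).
Proof.
rewrite !gmulE dilationE linear_sum; apply: eq_bigr => m _.
rewrite linear_sum; apply: eq_bigr => n _; rewrite linear_sum; apply: eq_bigr => pq _.
rewrite linearZ /= -dilationE dilation_nested map_flatten -map_comp.
congr (_ *: nested_bracket (flatten _)).
by apply: eq_map => i; rewrite /= map_cat !map_nseq.
Qed.

(** Both sides have the same exponential, because conjugation by exp X commutes with powers and
    equals the exponential of [adr X]. *)
Lemma rep_conj x y : rep (gmul (gmul (- x) y) x) =
  rep (\sum_(k < N + N) k`!%:R^-1 *: foldl (@bracket R M) y (nseq k x)).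
Proof.
have foldlE k z : rep (foldl (@bracket R M) z (nseq k x)) = (adr (rep x) ^+ k) (rep z).
  elim: k z => [//|k IHk] z; rewrite [nseq _ _]/= [foldl _ _ _]/= IHk exprSr endoME.
  by rewrite rep_bracket -adrE.
have -> : rep (\sum_(k < N + N) k`!%:R^-1 *: foldl (@bracket R M) y (nseq k x)) =
    aexp N (- rep x) * rep y * aexp N (rep x).
  rewrite -(aexp_adr _ (rep_nil x)) aexpE endo_sumE linear_sum.
  by apply: eq_bigr => k _; rewrite linearZ endoZE /= foldlE.
set a := aexp N (- rep x); set b := aexp N (rep x).
have ba1 : b * a = 1.
  by rewrite /b -{1}[rep x]opprK aexpN // exprNn rep_nil mulr0.
have conjX n : (a * rep y * b) ^+ n = a * rep y ^+ n * b.
  elim: n => [|n IHn]; first by rewrite !expr0 mulr1 /a /b aexpN // rep_nil.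
  rewrite !exprS IHn !mulrA -[_ * b * a]mulrA ba1 mulr1 //.
apply: (aexp_inj (rep_nil _)); first by rewrite conjX rep_nil mulr0 mul0r.
rewrite !rep_gmul linearN -/a -/b [aexp N (a * _ * _)]aexpE aexpE.
rewrite mulr_sumr mulr_suml; apply: eq_bigr => k _.
by rewrite conjX -scalerAr -scalerAl.
Qed.

(* Conjugation is linear in the conjugated element, hence continuous at [0] as
   soon as the bracket is, whatever the projections on the layers. *)
Lemma gmul_conj x y : gmul (gmul (- x) y) x =
  \sum_(k < N + N) k`!%:R^-1 *: foldl (@bracket R M) y (nseq k x).
Proof. exact/rep_inj/rep_conj. Qed.

End GroupRepresentation.

(** * Groups with dilations and a homogeneous norm *)

(** The common interface of G with the norm d(0, x) and of M with [hnorm], so that the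
    differentiation argument is written once. The last field is the substitute for right
    invariance. *)
Record normed_dil_group (R : realType) := NormedDilGroup {
  ndg_sort :> Type;
  dg_mul : ndg_sort -> ndg_sort -> ndg_sort;
  dg_inv : ndg_sort -> ndg_sort;
  dg_one : ndg_sort;
  dg_dil : R -> ndg_sort -> ndg_sort;
  dg_norm : ndg_sort -> R;
  dg_mulA : associative dg_mul;
  dg_mul1x : left_id dg_one dg_mul;
  dg_mulx1 : right_id dg_one dg_mul;
  dg_mulVx : left_inverse dg_one dg_inv dg_mul;
  dg_mulxV : right_inverse dg_one dg_inv dg_mul;
  dg_dilM : forall r x y, dg_dil r (dg_mul x y) = dg_mul (dg_dil r x) (dg_dil r y);
  dg_dilA : forall r s x, dg_dil r (dg_dil s x) = dg_dil (r * s) x;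
  dg_dil1 : forall x, dg_dil 1 x = x;
  dg_norm_ge0 : forall x, 0 <= dg_norm x;
  dg_norm0_eq1 : forall x, dg_norm x = 0 -> x = dg_one;
  dg_normV : forall x, dg_norm (dg_inv x) = dg_norm x;
  dg_normM : forall x y, dg_norm (dg_mul x y) <= dg_norm x + dg_norm y;
  dg_norm_dil : forall r x, 0 < r -> dg_norm (dg_dil r x) = r * dg_norm x;
  dg_norm_conj : forall v e, 0 < e -> exists2 c : R, 0 < c & forall w,
    dg_norm w < c -> dg_norm (dg_mul (dg_mul (dg_inv v) w) v) < e }.

Declare Scope dg_scope.
Delimit Scope dg_scope with dg.
Notation "x * y" := (dg_mul x y) : dg_scope.
Notation "x ^-1" := (dg_inv x) : dg_scope.

Section NormedDilGroupTheory.
Variables (R : realType) (G : normed_dil_group R).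
Implicit Types (x y z v w : G) (r s t e c : R).
Local Open Scope dg_scope.

Definition dg_dist x y : R := dg_norm (x^-1 * y).

Lemma dg_mulKx x y : x^-1 * (x * y) = y.
Proof. by rewrite dg_mulA dg_mulVx dg_mul1x. Qed.

Lemma dg_mulxK x y : x * (x^-1 * y) = y.
Proof. by rewrite dg_mulA dg_mulxV dg_mul1x. Qed.

Lemma dg_mulK x y : y * x * x^-1 = y.
Proof. by rewrite -dg_mulA dg_mulxV dg_mulx1. Qed.

Lemma dg_inv_uniq x y : x * y = dg_one G -> y = x^-1.
Proof. by move=> xy; rewrite -[y](dg_mulKx x) xy dg_mulx1. Qed.

Lemma dg_invM x y : (x * y)^-1 = y^-1 * x^-1.
Proof.
apply/esym/dg_inv_uniq; rewrite dg_mulA -[x * y * _]dg_mulA dg_mulxV dg_mulx1.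
exact: dg_mulxV.
Qed.

Lemma dg_invK x : (x^-1)^-1 = x.
Proof. by apply/esym/dg_inv_uniq/dg_mulVx. Qed.

Lemma dg_dil_one r : dg_dil r (dg_one G) = dg_one G.
Proof.
have := congr1 (dg_mul (dg_dil r (dg_one G))^-1) (dg_dilM r (dg_one G) (dg_one G)).
by rewrite dg_mulx1 dg_mulKx dg_mulVx.
Qed.

Lemma dg_dilV r x : dg_dil r x^-1 = (dg_dil r x)^-1.
Proof. by apply: dg_inv_uniq; rewrite -dg_dilM dg_mulxV dg_dil_one. Qed.

Lemma dg_norm1 : dg_norm (dg_one G) = 0%R.
Proof.
have := @dg_norm_dil R G 2 (dg_one G) ltac:(lra); rewrite dg_dil_one; lra.
Qed.

Lemma dg_dist_ge0 x y : (0 <= dg_dist x y)%R. Proof. exact: dg_norm_ge0. Qed.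

Lemma dg_distxx x : dg_dist x x = 0%R.
Proof. by rewrite /dg_dist dg_mulVx dg_norm1. Qed.

Lemma dg_distC x y : dg_dist x y = dg_dist y x.
Proof. by rewrite /dg_dist -dg_normV dg_invM dg_invK. Qed.

Lemma dg_dist_triangle y x z : (dg_dist x z <= dg_dist x y + dg_dist y z)%R.
Proof.
by rewrite /dg_dist -{1}[z](dg_mulxK y) dg_mulA dg_normM.
Qed.

Lemma dg_dist_mull z x y : dg_dist (z * x) (z * y) = dg_dist x y.
Proof. by rewrite /dg_dist dg_invM -dg_mulA dg_mulKx. Qed.

Lemma dg_dist_dil r x y : (0 < r)%R ->
  dg_dist (dg_dil r x) (dg_dil r y) = (r * dg_dist x y)%R.
Proof. by move=> r0; rewrite /dg_dist -dg_dilV -dg_dilM dg_norm_dil. Qed.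

Lemma dg_dist_mul_dil x y z t : (0 < t)%R ->
  dg_dist (x * dg_dil t y) (x * dg_dil t z) = (t * dg_dist y z)%R.
Proof. by move=> t0; rewrite dg_dist_mull dg_dist_dil. Qed.

Lemma dg_dist_mulx x y : dg_dist x (x * y) = dg_norm y.
Proof. by rewrite /dg_dist dg_mulKx. Qed.

Lemma dg_dilK r x : (0 < r)%R -> dg_dil r^-1%R (dg_dil r x) = x.
Proof. by move=> r0; rewrite dg_dilA mulVf ?gt_eqF // dg_dil1. Qed.

Lemma dg_dilVK r x : (0 < r)%R -> dg_dil r (dg_dil r^-1%R x) = x.
Proof. by move=> r0; rewrite dg_dilA mulfV ?gt_eqF // dg_dil1. Qed.

(** Continuity of conjugation by v is used at unit scale and then dilated, which makes c independent
    of t. *)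
Lemma dg_dist_mulr v e : (0 < e)%R -> exists2 c, (0 < c)%R & forall t x y,
  (0 < t)%R -> (dg_dist x y < c * t)%R ->
  (dg_dist (x * dg_dil t v)%dg (y * dg_dil t v)%dg < e * t)%R.
Proof.
move=> e0; have [c c0 hc] := dg_norm_conj v e0; exists c => // t x y t0 xy.
have {}xy : (dg_norm (dg_dil t^-1%R (x^-1 * y)%dg) < c)%R.
  by rewrite dg_norm_dil ?invr_gt0 // mulrC ltr_pdivrMr.
have := hc _ xy; rewrite -(ltr_pM2l t0) -dg_norm_dil // dg_dilM dg_dilM dg_dilVK // dg_dilV.
by rewrite mulrC /dg_dist dg_invM !dg_mulA.
Qed.

End NormedDilGroupTheory.

(** * Directional derivatives outside a porous set *)

Lemma exists_invSn_lt (R : realType) (e : R) : 0 < e -> exists n : nat, n.+1%:R^-1 < e.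
Proof.
move=> e0; have [n en] := @ltr_add_invr R 0 e e0; exists n.
by rewrite add0r in en.
Qed.

Section Porosity.
Variables (R : realType) (T : Type) (d : T -> T -> R).

Lemma porous_set0 : porous d set0.
Proof. by exists 1. Qed.

Lemma porous_at_points (E : set T) (l : R) : 0 < l ->
  porous d [set x | E x /\ porous_at d E l x].
Proof.
move=> l0; exists l => // x [_ [y [yx yneq yE]]]; exists y; split => // n.
by apply: subsetI_eq0 (yE n) => // z [].
Qed.

Lemma sigma_porous_countable (I : countType) (F : I -> set T) :
  (forall i, porous d (F i)) -> sigma_porous d (\bigcup_i F i).
Proof.
move=> pF; exists (fun n => if unpickle n is Some i then F i else set0).
  by move=> n; case: unpickle => // ; apply: porous_set0.
apply/seteqP; split=> [x [i _ Fx]|x [n _]].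
  by exists (pickle i) => //; rewrite pickleK.
by case: unpickle => // i Fx; exists i.
Qed.

End Porosity.

Section DirectionalDerivative.
Variables (R : realType) (G M : normed_dil_group R).
Variables (A : set G) (f : G -> M) (L : R).
Hypothesis L_ge0 : 0 <= L.
Hypothesis f_lip : forall x y, A x -> A y -> dg_dist (f x) (f y) <= L * dg_dist x y.
Implicit Types (x y p q zeta eta : G) (D : M) (r s t e c k : R).

(** A form of the directional derivative that quantifies over all nearby points of A instead of over
    approximating curves. *)
Definition dd_at x zeta D : Prop := forall e, 0 < e -> exists2 c, 0 < c &
  forall t p, 0 < t < c -> A p ->
    dg_dist p (x * dg_dil t zeta)%dg < c * t ->
    dg_dist (f p) (f x * dg_dil t D)%dg < e * t.

(** What the argument retains of a density point: A comes within o(t) of every x dil_t zeta. *)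
Definition dense_at x : Prop := forall zeta e, 0 < e -> exists2 c, 0 < c &
  forall t, 0 < t < c -> exists2 p, A p & dg_dist p (x * dg_dil t zeta)%dg < e * t.

Variables (a : nat -> G) (b : nat -> G).
Hypothesis a_dense : forall x e, 0 < e -> exists n, dg_dist x (a n) < e.
Hypothesis b_dense : forall x e, A x -> 0 < e ->
  exists2 n, A (b n) & dg_dist x (b n) < e.

Definition quotients (n : nat * nat * nat) : M :=
  dg_dil n.2.+1%:R (dg_mul (dg_inv (f (b n.1.1))) (f (b n.1.2))).

Lemma dd_quotients x eta D e : A x -> dense_at x -> dd_at x eta D -> 0 < e ->
  exists n, dg_dist D (quotients n) < e.
Proof.
move=> Ax dx ddx e0.
have e4 : 0 < e / 4 by lra.
have [c c0 hc] := ddx _ e4.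
have [c' c'0 hc'] := dx eta c c0.
have [n] := @exists_invSn_lt R (Num.min c c') ltac:(by rewrite lt_min c0).
set t := n.+1%:R^-1; rewrite lt_min => /andP[tc tc'].
have t0 : 0 < t by rewrite invr_gt0.
have [p Ap xp] := hc' t ltac:(by rewrite t0).
have fp := hc t p ltac:(by rewrite t0) Ap xp.
pose v := dg_mul (dg_inv (f x)) (f p).
have et4 : 0 < e / 4 * t by rewrite mulr_gt0.
(* Moving the base point from [f x] to [f (b j)] changes the increment v by a conjugate, by v, of a
   small element. How close [b j] must be to x is dictated by the continuity of that conjugation. *)
have [c2 c20 hc2] := dg_norm_conj v et4.
have L1 : 0 < L + 1 by move: L_ge0; lra.
have [j Aj xj] := b_dense Ax (divr_gt0 c20 L1).
have [k Ak pk] := b_dense Ap (divr_gt0 et4 L1).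
have lipS u w r : A u -> A w -> dg_dist u w < r / (L + 1) -> dg_dist (f u) (f w) < r.
  move=> Au Aw; rewrite ltr_pdivlMr // => uw.
  have := f_lip Au Aw; have := dg_dist_ge0 u w; nra.
exists (j, k, n); rewrite /quotients /=.
rewrite -(ltr_pM2l t0) -dg_dist_dil // dg_dilA mulVf ?dg_dil1; last by [].
set w := dg_mul (dg_inv (f (b j))) (f (b k)).
have h1 : dg_dist (dg_dil t D) v < e / 4 * t.
  by rewrite /v dg_distC -(dg_dist_mull (f x)) dg_mulxK.
have h2 : dg_dist w v < e / 4 * t + e / 4 * t.
  have -> : dg_dist w v = dg_norm (dg_mul
      (dg_mul (dg_mul (dg_inv v) (dg_mul (dg_inv (f (b j))) (f x))) v)
      (dg_mul (dg_inv (f p)) (f (b k)))).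
    rewrite dg_distC /dg_dist /w /v dg_invM dg_invK !dg_mulA !dg_mulK.
    by [].
  apply: le_lt_trans (dg_normM _ _) _; apply: ltrD; last exact: lipS Ap Ak pk.
  by apply: hc2; rewrite -[X in X < _]/(dg_dist (f (b j)) (f x)) dg_distC; apply: lipS xj.
have := dg_dist_triangle v (dg_dil t D) w; rewrite (dg_distC v w); lra.
Qed.

(* The constant [3 * L + 2] is the loss in [mem_increment_set], when [zeta] and
   [D] are replaced by members of countable families. *)
Definition increment_set zeta D e k : set G := [set y | A y /\
  forall t p, 0 < t < k -> A p -> dg_dist p (y * dg_dil t zeta)%dg < e * t ->
    dg_dist (f p) (f y * dg_dil t D)%dg < (3 * L + 2) * e * t].

Lemma mem_increment_set x eta eta' D D' e : A x -> dense_at x -> dd_at x eta D ->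
  0 < e -> dg_dist eta eta' < e -> dg_dist D D' < e ->
  exists2 k, 0 < k & increment_set eta' D' e k x.
Proof.
move=> Ax dx ddx e0 etae De.
have [c2 c20 hc2] := ddx _ e0.
have m0 : 0 < Num.min c2 e by rewrite lt_min c20.
have [c3 c30 hc3] := dx eta _ m0.
exists (Num.min c2 c3); first by rewrite lt_min c20.
split=> // t p /andP[t0]; rewrite lt_min => /andP[tc2 tc3] Ap xp.
(* p is only near x dil_t eta'. The derivative is applied at a point q of A much nearer to x dil_t
   eta; then p and q are at distance less than 3 e t, which costs 3 L e t, and q and the change from
   D to D' cost e t each. *)
have [q Aq xq] := hc3 t ltac:(by rewrite t0).
have xq2 : dg_dist q (x * dg_dil t eta)%dg < c2 * t.
  by apply: lt_le_trans xq _; rewrite ler_pM2r // ge_min lexx.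
have xqe : dg_dist q (x * dg_dil t eta)%dg < e * t.
  by apply: lt_le_trans xq _; rewrite ler_pM2r // ge_min lexx orbT.
have fq := hc2 t q ltac:(by rewrite t0) Aq xq2.
have h1 := dg_dist_mul_dil x eta eta' t0.
have h2 := dg_dist_mul_dil (f x) D D' t0.
have h3 := dg_dist_triangle (x * dg_dil t eta')%dg p q.
have h4 := dg_dist_triangle (x * dg_dil t eta)%dg (x * dg_dil t eta')%dg q.
rewrite [dg_dist (_ * dg_dil t eta')%dg (_ * dg_dil t eta)%dg]dg_distC in h4.
rewrite [dg_dist (x * dg_dil t eta)%dg q]dg_distC in h4.
have h5 := dg_dist_triangle (f q) (f p) (f x * dg_dil t D')%dg.
have h6 := dg_dist_triangle (f x * dg_dil t D)%dg (f q) (f x * dg_dil t D')%dg.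
have h7 := f_lip Ap Aq.
have h8 : t * dg_dist eta eta' < t * e by rewrite ltr_pM2l.
have h9 : t * dg_dist D D' < t * e by rewrite ltr_pM2l.
have h10 : L * dg_dist p q <= L * (3 * (e * t)) by apply: ler_wpM2l => //; lra.
lra.
Qed.

(** The constant choice p = x is admissible for the zero direction, and its increment is trivial. *)
Lemma dd_at_one x D : A x -> dd_at x (dg_one G) D -> D = dg_one M.
Proof.
move=> Ax ddx; apply: dg_norm0_eq1; apply/eqP; rewrite eq_le dg_norm_ge0 andbT.
apply/ler_addgt0Pr => e e0; rewrite add0r; have [c c0 hc] := ddx _ e0.
have t0 : 0 < c / 2 by lra.
have := hc (c / 2) x ltac:(apply/andP; split; lra) Ax.
rewrite dg_dil_one dg_mulx1 dg_distxx dg_dist_mulx dg_norm_dil // mulr_gt0 //.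
by move=> /(_ isT); rewrite mulrC ltr_pM2r // => /ltW.
Qed.

Definition porous_piece (i : nat * (nat * nat * nat) * nat * nat * nat) : set G :=
  let: (n1, n2, m, k, l) := i in
  let E := increment_set (a n1) (quotients n2) m.+1%:R^-1 k.+1%:R^-1 in
  [set x | E x /\ porous_at (@dg_dist R G) E l.+1%:R^-1 x].

Definition exceptional_set : set G := \bigcup_i porous_piece i.

Lemma exceptional_sigma_porous : sigma_porous (@dg_dist R G) exceptional_set.
Proof.
apply: sigma_porous_countable => -[[[[n1 n2] m] k] l].
by apply: porous_at_points; rewrite invr_gt0.
Qed.

Lemma increment_setW zeta D e k k' : k' <= k ->
  increment_set zeta D e k `<=` increment_set zeta D e k'.
Proof.
move=> kk y [Ay hy]; split=> // t p /andP[t0 tk].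
by apply: hy; rewrite t0 (lt_le_trans tk).
Qed.

(* If the increment of [f] from [x * dil t zeta] in direction [eta] is wrong,
   then a ball around this point, of radius comparable to [t], misses the
   increment set that contains [x]. *)
Lemma dd_at_mul x zeta eta D1 D2 : A x -> dense_at x -> ~ exceptional_set x ->
  dd_at x zeta D1 -> dd_at x eta D2 -> dd_at x (zeta * eta)%dg (D1 * D2)%dg.
Proof.
move=> Ax dx xP dd1 dd2.
(* The centres x dil_t zeta of the holes must differ from x, so the zero direction is treated
   apart. *)
have [zeta0|zeta_neq0] := eqVneq (dg_norm zeta) 0.
  move: dd1; rewrite (dg_norm0_eq1 zeta0) => /(dd_at_one Ax) ->.
  by rewrite !dg_mul1x.
have zeta_gt0 : 0 < dg_norm zeta by rewrite lt_def zeta_neq0 dg_norm_ge0.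
apply: contrapT => /existsNP[e /not_implyP[e0 bad]]; apply: xP.
(* 3 L + 2 comes from the increment set. The other 2 covers the errors k from translating by D' on
   the right and k / 3 from replacing D2 by D'. *)
pose C := 3 * L + 2 + 2; have C0 : 0 < C by rewrite /C; move: L_ge0; lra.
have [m mk] := exists_invSn_lt (divr_gt0 e0 C0); move: mk.
set k := m.+1%:R^-1; rewrite ltr_pdivlMr // => mk.
have k0 : 0 < k by rewrite invr_gt0.
have k3 : 0 < k / 3 by lra.
have [n1 etan1] := a_dense eta k3.
have [n2 Dn2] := dd_quotients Ax dx dd2 k3.
set eta' := a n1 in etan1; set D' := quotients n2 in Dn2.
have kk : k / 3 < k by lra.
have [h h0 hE] := mem_increment_set Ax dx dd2 k0 (lt_trans etan1 kk) (lt_trans Dn2 kk).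
have [j jh] := exists_invSn_lt h0.
have {}hE := increment_setW (ltW jh) hE; set E := increment_set _ _ _ _ in hE.
(* Three errors of k / 3 will add up to k: the position of the bad point p, the change from eta to
   eta', and the move of the base point from y n to w. *)
have [c1 c10 hc1] := dg_dist_mulr eta' k3.
have [e1 e10 he1] := dg_dist_mulr D' k0.
have [c2 c20 hc2] := dd1 _ e10.
pose c := Num.min c1 c2; have c0 : 0 < c by rewrite lt_min c10.
(* The porosity constant 1 / (l + 1): since d(x, y n) is t times the norm of zeta, the hole has
   radius less than c t. *)
have [l lc] := exists_invSn_lt (divr_gt0 c0 zeta_gt0).
move: lc; rewrite ltr_pdivlMr // => lc.
exists (n1, n2, m, j, l) => //; split => //.
have badn n : exists t, [/\ 0 < t, t < n.+1%:R^-1, t < c2, t < j.+1%:R^-1 & exists p,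
   [/\ A p, dg_dist p (x * dg_dil t (zeta * eta))%dg < k / 3 * t &
     e * t <= dg_dist (f p) (f x * dg_dil t (D1 * D2))%dg]].
  pose s := Num.min (Num.min n.+1%:R^-1 c2) (Num.min j.+1%:R^-1 (k / 3)).
  have s0 : 0 < s by rewrite !lt_min !invr_gt0 !ltr0Sn c20 k3.
  apply: contrapT => /forallNP nbad; apply: bad; exists s => // t p /andP[t0].
  rewrite !lt_min -!andbA => /and4P[tn tc2 tj tk] Ap xp.
  rewrite ltNge; apply/negP => fp; apply: (nbad t); split => //.
  exists p; split => //; apply: lt_le_trans xp _; rewrite ler_pM2r //.
  by rewrite !ge_min lexx !orbT.
have [t ht] := choice badn.
pose y n := (x * dg_dil (t n) zeta)%dg.
have xy n : dg_dist x (y n) = t n * dg_norm zeta.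
  by have [t0 _ _ _ _] := ht n; rewrite dg_dist_mulx dg_norm_dil.
exists y; split.
- apply/cvgrPdist_lt => r r0.
  have [n0 hn0] := exists_invSn_lt (divr_gt0 r0 zeta_gt0).
  exists n0 => // n /= n0n; have [t0 tn _ _ _] := ht n.
  rewrite sub0r normrN dg_distC xy ger0_norm; last first.
    by rewrite mulr_ge0 // ?dg_norm_ge0 // ltW.
  rewrite -ltr_pdivlMr //; apply: lt_trans tn _; apply: le_lt_trans hn0.
  by rewrite lef_pV2 ?posrE // ler_nat.
- move=> n yx; have := xy n; rewrite yx dg_distxx => /eqP.
  by have [t0 _ _ _ _] := ht n; rewrite eq_sym mulf_eq0 !gt_eqF.
- move=> n; apply/seteqP; split=> // w [wy [Aw hw]]; have := xy n.
  have [t0 _ tc2 tj [p [Ap xp fp]]] := ht n.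
  move: wy; rewrite /dball /= => + xyn; rewrite xyn => wy.
  have {}wy : dg_dist w (y n) < c * t n.
    rewrite dg_distC; apply: lt_trans wy _.
    by rewrite mulrCA mulrC ltr_pM2r.
  have wy1 : dg_dist w (y n) < c1 * t n.
    by apply: lt_le_trans wy _; rewrite ler_pM2r // ge_min lexx.
  have wy2 : dg_dist w (y n) < c2 * t n.
    by apply: lt_le_trans wy _; rewrite ler_pM2r // ge_min lexx orbT.
  have g1 := hc1 _ _ _ t0 wy1.
  have g2 := he1 _ _ _ t0 (hc2 (t n) w ltac:(by rewrite t0) Aw wy2).
  have g3 := dg_dist_mul_dil (y n) eta eta' t0.
  have g4 := dg_dist_mul_dil (f x * dg_dil (t n) D1)%dg D2 D' t0.
  have yE : (x * dg_dil (t n) (zeta * eta))%dg = (y n * dg_dil (t n) eta)%dg.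
    by rewrite dg_dilM dg_mulA.
  rewrite yE in xp; rewrite dg_dilM dg_mulA in fp.
  have wp : dg_dist p (w * dg_dil (t n) eta')%dg < k * t n.
    have g5 := dg_dist_triangle (y n * dg_dil (t n) eta)%dg p (w * dg_dil (t n) eta')%dg.
    have g6 := dg_dist_triangle (y n * dg_dil (t n) eta')%dg
      (y n * dg_dil (t n) eta)%dg (w * dg_dil (t n) eta')%dg.
    have g7 : t n * dg_dist eta eta' < t n * (k / 3) by rewrite ltr_pM2l.
    rewrite (dg_distC (y n * dg_dil (t n) eta')%dg) in g6.
    lra.
  have fw : dg_dist (f p) (f w * dg_dil (t n) D')%dg < (3 * L + 2) * k * t n.
    by apply: hw => //; rewrite t0.
  have g8 := dg_dist_triangle (f w * dg_dil (t n) D')%dg (f p)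
    (f x * dg_dil (t n) D1 * dg_dil (t n) D2)%dg.
  have g9 := dg_dist_triangle (f x * dg_dil (t n) D1 * dg_dil (t n) D')%dg
    (f w * dg_dil (t n) D')%dg (f x * dg_dil (t n) D1 * dg_dil (t n) D2)%dg.
  rewrite (dg_distC (f x * dg_dil (t n) D1 * dg_dil (t n) D')%dg) in g9.
  have g10 : t n * dg_dist D2 D' < t n * (k / 3) by rewrite ltr_pM2l.
  have : k * C * t n < e * t n by rewrite ltr_pM2r.
  have kt0 : 0 < k * t n by rewrite mulr_gt0.
  rewrite /C; lra.
Qed.

End DirectionalDerivative.

(** * The homogeneous norm *)

Lemma cvg_bigsum (R : realType) (V : normedModType R) (T : Type) (F : set_system T)
    {FF : Filter F} (I : Type) (r : seq I) (P : pred I) (u : I -> T -> V) (l : I -> V) :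
  (forall i, P i -> u i @ F --> l i) ->
  (fun t => \sum_(i <- r | P i) u i t) @ F --> \sum_(i <- r | P i) l i.
Proof.
move=> ul; elim: r => [|i r IHr].
  by rewrite big_nil; under eq_fun do rewrite big_nil; apply: cvg_cst.
rewrite big_cons; under eq_fun do rewrite big_cons.
by case: (boolP (P i)) => [/ul ui|_] //; have := cvgD ui IHr; apply.
Qed.

Lemma cvg_bigsum0 (R : realType) (V : normedModType R) (T : Type) (F : set_system T)
    {FF : Filter F} (I : Type) (r : seq I) (P : pred I) (u : I -> T -> V) :
  (forall i, P i -> u i @ F --> 0) -> (fun t => \sum_(i <- r | P i) u i t) @ F --> 0.
Proof.
by move=> /(@cvg_bigsum _ _ _ _ _ _ r _ _ (fun=> 0)); rewrite big1.
Qed.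

Section HomogeneousNorm.
Variables (R : realType) (M : banach_homogeneous_group R) (sigma : nat -> R).
Hypothesis sigma_gt0 : forall i, (1 <= i <= step M)%N -> 0 < sigma i.
Implicit Types (x y z : M) (r e : R).
Local Notation nu := (step M).
Local Notation pr := (@layer_proj R M).
Local Notation N := (@hnorm R M sigma).

Let sigmaS_gt0 (i : 'I_nu) : 0 < sigma i.+1.
Proof. by apply: sigma_gt0; rewrite /= ltn_ord. Qed.

Let rootK n r : 0 <= r -> (r `^ n.+1%:R^-1) ^+ n.+1 = r.
Proof.
by move=> r0; rewrite -powR_mulrn ?powR_ge0 // -powRrM mulVf ?pnatr_eq0 // powRr1.
Qed.

Lemma hnorm_ge0 x : 0 <= N x.
Proof. by apply: bigmax_ge_id. Qed.

Lemma hnorm_ltP x e : 0 < e ->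
  reflect (forall i : 'I_nu, `|pr i x| < (e / sigma i.+1) ^+ i.+1) (N x < e).
Proof.
move=> e0; have es0 (i : 'I_nu) : e / sigma i.+1 \is Num.nneg.
  by rewrite nnegrE ltW // divr_gt0.
have pn (i : 'I_nu) : `|pr i x| `^ i.+1%:R^-1 \is Num.nneg by rewrite nnegrE powR_ge0.
apply: (iffP (bigmax_ltP _ _ _ _)) => [[_ h] i|h].
  have := h i isT; rewrite mulrC -ltr_pdivlMr // -(@ltr_pXn2r _ i.+1) //.
  by rewrite rootK.
split=> // i _; rewrite mulrC -ltr_pdivlMr // -(@ltr_pXn2r _ i.+1) //.
by rewrite rootK.
Qed.

Lemma hnorm_eq0 x : N x = 0 -> x = 0.
Proof.
move=> Nx; apply: layer_proj_inj => i; rewrite linear0; apply/eqP; rewrite -normr_eq0.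
suff : sigma i.+1 * `|pr i x| `^ i.+1%:R^-1 <= 0.
  rewrite pmulr_rle0 // => le0; apply/eqP/(@powR_eq0_eq0 _ _ i.+1%:R^-1)/eqP.
  by rewrite eq_le le0 powR_ge0.
rewrite -Nx /hnorm.
exact: (le_bigmax _ (fun i : 'I_nu => sigma i.+1 * `|pr i x| `^ i.+1%:R^-1)).
Qed.

Lemma hnormN x : N (- x) = N x.
Proof. by apply: eq_bigr => i _; rewrite linearN normrN. Qed.

Lemma hnorm_dilation r x : 0 < r -> N (dilation r x) = r * N x.
Proof.
move=> r0; rewrite /hnorm.
rewrite (big_morph (fun a : R => r * a) (fun a b => maxr_pMr a b (ltW r0)) (mulr0 r)).
apply: eq_bigr => i _; rewrite dilationE layer_proj_weight normrZ mulrCA.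
congr (_ * _); rewrite powRM // normrX (gtr0_norm r0); congr (_ * _).
by rewrite -powR_mulrn ?ltW // -powRrM mulfV ?pnatr_eq0 // powRr1 // ltW.
Qed.

(** Convergence is tested on each projection separately, which avoids any appeal to the continuity
    of the projections on M. *)
Lemma cvg_hnorm0 (T : Type) (F : set_system T) {FF : Filter F} (u : T -> M) :
  (fun t => N (u t)) @ F --> 0 <-> forall i, (fun t => pr i (u t)) @ F --> (0 : M).
Proof.
split=> [uN i|up].
  apply/cvgr0Pnorm_lt => e e0.
  have e'0 : 0 < e `^ i.+1%:R^-1 * sigma i.+1 by rewrite mulr_gt0 ?powR_gt0.
  move/cvgr0Pnorm_lt : uN => /(_ _ e'0); apply: filterS => t.
  rewrite ger0_norm ?hnorm_ge0 // => /(hnorm_ltP _ e'0) /(_ i).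
  by rewrite mulfK ?rootK ?gt_eqF // ltW.
apply/cvgr0Pnorm_lt => e e0.
have : \forall t \near F, forall i : 'I_nu, `|pr i (u t)| < (e / sigma i.+1) ^+ i.+1.
  apply: filter_forall => i; move/cvgr0Pnorm_lt : (up i); apply.
  by rewrite exprn_gt0 // divr_gt0.
apply: filterS => t /(hnorm_ltP _ e0).
by rewrite ger0_norm ?hnorm_ge0.
Qed.

Lemma cvg_layers_bracket (T : Type) (F : set_system T) {FF : Filter F} (u : T -> M) x :
  (forall i, (fun t => pr i (u t)) @ F --> (0 : M)) ->
  forall i, (fun t => pr i (bracket (u t) x)) @ F --> (0 : M).
Proof.
move=> u0 i; under eq_fun do rewrite layer_proj_bracket.
apply: cvg_bigsum0 => jk _; rewrite -(bracket0l (pr jk.2 x)).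
apply: (@cvg_comp _ _ _ (fun t => (pr jk.1 (u t), pr jk.2 x)) (fun p => bracket p.1 p.2)
  F (nbhs (0, pr jk.2 x))); last exact: (@bracket_continuous R M (0, pr jk.2 x)).
by apply: cvg_pair; [apply: u0|apply: cvg_cst].
Qed.

Lemma cvg_layers_conj (T : Type) (F : set_system T) {FF : Filter F} (u : T -> M) x :
  (forall i, (fun t => pr i (u t)) @ F --> (0 : M)) ->
  forall i, (fun t => pr i (gmul (gmul (- x) (u t)) x)) @ F --> (0 : M).
Proof.
move=> u0 i; under eq_fun do rewrite gmul_conj linear_sum.
apply: cvg_bigsum0 => k _; under eq_fun do rewrite linearZ /=.
rewrite -(scaler0 _ (k`!%:R^-1 : R)); apply: cvgZl_tmp.
elim: (nat_of_ord k) u u0 => [|n IHn] u u0 //=.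
by apply: IHn; apply: cvg_layers_bracket.
Qed.

Lemma hnorm_conj x e : 0 < e -> exists2 c : R, 0 < c & forall w : M,
  N w < c -> N (gmul (gmul (- x) w) x) < e.
Proof.
(* F is the neighbourhood filter of 0 for [hnorm]; the claim becomes a limit along F. *)
move=> e0; pose F := filter_from [set c : R | 0 < c] (fun c => [set w | N w < c]).
have FF : Filter F.
  apply: filter_from_filter; first by exists 1 => /=.
  move=> c1 c2 /= c10 c20; exists (Num.min c1 c2); rewrite /= ?lt_min ?c10 //.
  by move=> w /=; rewrite lt_min => /andP.
have F0 : N @ F --> 0.
  apply/cvgr0Pnorm_lt => r r0; exists r => // w /=.
  by rewrite ger0_norm ?hnorm_ge0.
have /cvg_hnorm0 : forall i, (fun w => pr i (gmul (gmul (- x) w) x)) @ F --> (0 : M).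
  by apply: cvg_layers_conj; apply/cvg_hnorm0.
move=> /cvgr0Pnorm_lt /(_ _ e0) [c c0 hc]; exists c => // w /hc /=.
by rewrite ger0_norm ?hnorm_ge0.
Qed.

End HomogeneousNorm.

Section DilationGroup.
Variables (R : realType) (M : banach_homogeneous_group R).
Implicit Types (x : M) (r s : R).

Lemma dilationM r s x : dilation r (dilation s x : M) = dilation (r * s) x :> M.
Proof.
apply: layer_proj_inj => i; rewrite !dilationE !layer_proj_weight scalerA.
by rewrite exprMn.
Qed.

Lemma dilation1 x : dilation 1 x = x.
Proof.
by apply: layer_proj_inj => i; rewrite dilationE layer_proj_weight expr1n scale1r.
Qed.

End DilationGroup.

Definition bhg_normed_dil (R : realType) (M : banach_homogeneous_group R)
    (sigma : nat -> R) (s0 : forall i, (1 <= i <= step M)%N -> 0 < sigma i)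
    (sM : forall x y : M, hnorm sigma (gmul x y) <= hnorm sigma x + hnorm sigma y) :
    normed_dil_group R :=
  @NormedDilGroup R M (@gmul R M) (@ginv R M) 0 (@dilation R M) (hnorm sigma)
    (@gmulA R M) (@gmul0l R M) (@gmul0 R M) (@gmulNx R M) (@gmulxN R M)
    (@dilation_gmul R M) (@dilationM R M) (@dilation1 R M)
    (@hnorm_ge0 R M sigma) (@hnorm_eq0 R M sigma s0) (@hnormN R M sigma) sM
    (@hnorm_dilation R M sigma) (@hnorm_conj R M sigma s0).

(** * Finite dimensional normed spaces *)

Lemma ler_row_norm (R : realType) n (c : 'rV[R]_n) j : `|c 0 j| <= `|c|.
Proof.
change (`|c 0 j| <= mx_norm c); rewrite mx_normE -[leLHS]nngE num_le.
exact: (le_bigmax _ (fun i : 'I_1 * 'I_n => `|c i.1 i.2|%:nng) (0, j)).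
Qed.

Section FiniteDimension.
Variables (R : realType) (V : normedModType R).

Definition lincomb n (e : 'I_n -> V) (c : 'rV[R]_n) : V := \sum_i c 0 i *: e i.

Lemma lincomb_linear n (e : 'I_n -> V) : linear (lincomb e).
Proof.
move=> a c c'; rewrite /lincomb scaler_sumr -big_split; apply: eq_bigr => i _.
by rewrite !mxE scalerDl scalerA.
Qed.

HB.instance Definition _ n (e : 'I_n -> V) :=
  GRing.isLinear.Build R 'rV[R]_n V _ (lincomb e) (lincomb_linear e).

Lemma lincomb_continuous n (e : 'I_n -> V) : continuous (lincomb e).
Proof.
move=> c; apply: (@cvg_bigsum _ _ _ (nbhs c) (nbhs_filter c)) => i _.
by apply: cvgZr_tmp; apply: coord_continuous.
Qed.

Definition spanning n (e : 'I_n -> V) := forall x, exists c, x = lincomb e c.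

(** A spanning family of least size is free, as a nontrivial relation would eliminate one of its
    members. *)
Lemma exists_free_spanning n (e : 'I_n -> V) : spanning e ->
  exists m (b : 'I_m -> V), spanning b /\ injective (lincomb b).
Proof.
move=> spe; pose P m := `[< exists b : 'I_m -> V, spanning b >].
have exP : exists m, P m by exists n; apply/asboolP; exists e.
case: (ex_minnP exP) => m /asboolP [b spb] mmin; exists m, b; split => // c c' cc'.
apply/eqP; rewrite -subr_eq0; apply/eqP.
have {cc'} : lincomb b (c - c') = 0 by rewrite linearB /= cc' subrr.
move: (c - c') => {c c'}c bc0; apply/rowP => k; rewrite mxE; apply/eqP/negPn/negP => ck.
case: m b spb mmin c bc0 k ck => [|m] b spb mmin c bc0 k ck; first by case: k ck.
suff : P m by move=> /mmin; rewrite ltnn.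
apply/asboolP; exists (fun i => b (lift k i)) => x.
have [c' ->] := spb x.
exists (\row_i (c' 0 (lift k i) - c' 0 k / c 0 k * c 0 (lift k i))).
rewrite -[LHS]subr0 -(scaler0 _ (c' 0 k / c 0 k)) -{}bc0 /lincomb.
rewrite !(bigD1_ord k) //= scalerDr scalerA divfK // opprD addrACA subrr add0r.
rewrite scaler_sumr -sumrB; apply: eq_bigr => i _.
by rewrite mxE scalerBl scalerA.
Qed.

(** k is the minimum of the norm of [lincomb b] on the unit sphere, positive by freeness; a nonzero
    vector ensures that the sphere is nonempty. *)
Lemma finite_dim_coord n (e : 'I_n -> V) : spanning e -> (exists x : V, x != 0) ->
  exists m (b : 'I_m.+1 -> V) (k : R), [/\ 0 < k, spanning b &
    forall c, k * `|c| <= `|lincomb b c|].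
Proof.
move=> spe [x0 x0_neq0]; have [[|m] [b [spb injb]]] := exists_free_spanning spe.
  by move: x0_neq0; have [c ->] := spb x0; rewrite /lincomb big_ord0 eqxx.
exists m, b.
pose S := [set c : 'rV[R]_m.+1 | `|c| = 1].
have normed (c : 'rV[R]_m.+1) : c != 0 -> S (`|c|^-1 *: c).
  by move=> c0; rewrite /S /= normrZ normfV normr_id mulVf // normr_eq0.
have S0 : S !=set0.
  have [c x0E] := spb x0; exists (`|c|^-1 *: c); apply: normed.
  by apply: contra_neq x0_neq0 => c0; rewrite x0E c0 linear0.
have cS : compact S.
  apply: bounded_closed_compact.
    exists 1; split; first exact: num_real.
    by move=> r r1 c /= ->; rewrite ltW.
  have nc : continuous (fun c : 'rV[R]_m.+1 => `|c|) by apply: norm_continuous.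
  exact: (iffLR (continuous_closedP _) nc _ (@closed_eq _ 1)).
have [|c cS' cmin] := @compact_EVT_min _ R (fun c => `|lincomb b c|) S S0 cS.
  apply: continuous_subspaceT => c; apply: continuous_comp.
    exact: lincomb_continuous.
  exact: norm_continuous.
have bc0 : 0 < `|lincomb b c|.
  rewrite normr_gt0; apply/eqP => bc; move: cS'; rewrite inE /S /=.
  have -> : c = 0 by apply: injb; rewrite bc linear0.
  by rewrite normr0 => /esym/eqP; rewrite oner_eq0.
exists `|lincomb b c|; split => // c'.
have [->|c'0] := eqVneq c' 0; first by rewrite normr0 mulr0.
have := cmin (`|c'|^-1 *: c'); rewrite inE => /(_ (normed _ c'0)).
rewrite linearZ /= normrZ normfV normr_id mulrC.
by rewrite ler_pdivlMr ?normr_gt0.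
Qed.

End FiniteDimension.

(** * Continuity of the group operation *)

Section GmulContinuity.
Variables (R : realType) (M : banach_homogeneous_group R).
Local Notation pr := (@layer_proj R M).

Section Limits.
Context {T : Type} {F : set_system T} {FF : Filter F}.
Variables (u v : T -> M) (a b : M).
Hypotheses (ua : u @ F --> a) (vb : v @ F --> b).

Lemma cvg_nested_bracket (I : Type) (w : I -> T -> M) (l : I -> M) (s : seq I) :
  (forall i, w i @ F --> l i) ->
  (fun t => nested_bracket [seq w i t | i <- s]) @ F --> nested_bracket (map l s).
Proof.
move=> wl; case: s => [|i s] /=; first exact: cvg_cst.
elim: s (w i) (l i) (wl i) => [|j s IHs] w' l' wl' //=.
apply: IHs; apply: (@cvg_comp _ _ _ (fun t => (w' t, w j t)) (fun p => bracket p.1 p.2)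
  F (nbhs (l', l j))); last exact: (@bracket_continuous R M (l', l j)).
by apply: cvg_pair => //; apply: wl.
Qed.

Lemma cvg_gmul : (fun t => gmul (u t) (v t)) @ F --> gmul a b.
Proof.
rewrite gmulE; under eq_fun do rewrite gmulE.
apply: cvg_bigsum => m _; apply: cvg_bigsum => n _; apply: cvg_bigsum => pq _.
apply: cvgZl_tmp.
pose w (c : bool) t := if c then u t else v t.
have wl c : w c @ F --> (if c then a else b) by case: c.
have blocksE x y : flatten [seq nseq (pq i).1 x ++ nseq (pq i).2 y | i <- enum 'I_n] =
    [seq (if c then x else y) | c <- flatten
      [seq nseq (pq i).1 true ++ nseq (pq i).2 false | i <- enum 'I_n]] :> seq M.
  rewrite map_flatten -map_comp; congr flatten; apply: eq_map => i /=.
  by rewrite map_cat !map_nseq.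
rewrite blocksE; under eq_fun do rewrite blocksE.
exact: (cvg_nested_bracket wl).
Qed.

End Limits.

Definition low_zero j (x : M) := forall i : 'I_(step M), (i < j)%N -> pr i x = 0.

Lemma low_zero_bracket j x y :
  low_zero j x -> low_zero j y -> low_zero j.+1 (bracket x y).
Proof.
move=> lx ly i ij; rewrite layer_proj_bracket big1 // => jk /eqP ijk.
by rewrite lx ?bracket0l //; lia.
Qed.

Lemma low_zeroW j k x : (k <= j)%N -> low_zero j x -> low_zero k x.
Proof. by move=> kj lx i ik; apply: lx; apply: leq_trans kj. Qed.

Lemma low_zero_nested j s : (forall x, List.In x s -> low_zero j x) ->
  (1 < size s)%N -> low_zero j.+1 (nested_bracket s).
Proof.
case: s => [//|x [//|y s]] ls _ /=.
have : low_zero j.+1 (bracket x y).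
  by apply: low_zero_bracket; apply: ls => /=; [left|right; left].
have {}ls z : List.In z s -> low_zero j z by move=> zs; apply: ls; right; right.
elim: s (bracket x y) ls => [//|z s IHs] c ls lc /=; apply: IHs.
  by move=> k ks; apply: ls; right.
by apply: low_zero_bracket; [apply: low_zeroW lc|apply: ls; left].
Qed.

(** On elements without components in layers 1 to j, brackets also lose layer j + 1, so the group
    law is additive up to that layer. *)
Lemma layer_proj_gmul j x y (i : 'I_(step M)) : (i <= j)%N ->
  low_zero j x -> low_zero j y -> pr i (gmul x y) = pr i x + pr i y.
Proof.
move=> ij lx ly; rewrite /gmul !linearD /= linear_sum big_nat big1 ?addr0 //=.
move=> m /andP[m2 _]; rewrite linear_sum big1 // => n _.
rewrite linear_sum big1 // => pq /andP[_ /eqP degm]; rewrite linearZ /=.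
rewrite (@low_zero_nested j _ _ _ i) ?scaler0 //.
  move=> z.
  have in_nseq k w : low_zero j w -> List.In z (nseq k w) -> low_zero j z.
    by move=> lw; elim: k => [//|k IHk] /= [<-|/IHk].
  elim: (enum 'I_n) => [//|k s IHs] /=.
  move=> /(@List.in_app_or _ _ _ _) [|/IHs//].
  by move=> /(@List.in_app_or _ _ _ _) []; apply: in_nseq.
apply: leq_trans m2 _; rewrite -[X in (X <= _)%N]degm.
rewrite size_flatten /shape -map_comp sumnE big_map big_enum /=.
by apply: leq_sum => k _; rewrite size_cat !size_nseq.
Qed.

End GmulContinuity.

(** * Homogeneous distances on finite dimensional groups *)

Section HomogeneousDistance.
Variables (R : realType) (G : banach_homogeneous_group R).
Variables (n : nat) (e : 'I_n -> G).
Hypothesis spe : spanning e.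
Variable d : G -> G -> R.
Hypothesis hd : homogeneous_distance d.
Implicit Types (x y z : G) (r s : R).
Local Notation nu := (step G).
Local Notation pr := (@layer_proj R G).

Lemma hdistE x y : d x y = d 0 (gmul (- x) y).
Proof. by have [_ dl _] := hd; rewrite -(dl x y (- x)) gmulNx. Qed.

Lemma hdist0_ge0 x : 0 <= d 0 x. Proof. by have [[]] := hd. Qed.

Lemma hdist0_eq0 x : d 0 x = 0 -> x = 0.
Proof. by have [[_ d0 _ _] _ _] := hd; move/d0 => <-. Qed.

Lemma hdist00 : d 0 0 = 0. Proof. by have [[_ d0 _ _] _ _] := hd; apply/d0. Qed.

Lemma hdist0N x : d 0 (- x) = d 0 x.
Proof.
have [[_ _ dC _] _ _] := hd.
by rewrite dC [RHS]hdistE hdistE opprK oppr0 gmul0 gmul0l.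
Qed.

Lemma hdist0M x y : d 0 (gmul x y) <= d 0 x + d 0 y.
Proof.
have [[_ _ _ dT] _ _] := hd; apply: le_trans (dT _ x _) _.
by rewrite [X in _ + X <= _]hdistE gmulA gmulNx gmul0l.
Qed.

Lemma hdist0_dilation r x : 0 < r -> d 0 (dilation r x) = r * d 0 x.
Proof.
move=> r0; have [_ _ ddil] := hd; rewrite -ddil // dilationE.
by rewrite (linear0 (weight_map _)).
Qed.

(** On a layer, scaling by s is a dilation up to sign. Dilations have positive ratio, hence the
    presence of both y and - y. *)
Lemma hdist0_line (i : 'I_nu) y s : layer G i.+1 y ->
  d 0 (s *: y) <= `|s| `^ i.+1%:R^-1 * (d 0 y + d 0 (- y)).
Proof.
move=> ly; have dil r z : layer G i.+1 z -> 0 < r ->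
    d 0 (r *: z) = r `^ i.+1%:R^-1 * d 0 z.
  move=> lz r0; rewrite -hdist0_dilation ?powR_gt0 //; congr (d 0 _).
  apply: layer_proj_inj => j; rewrite dilationE layer_proj_weight linearZ /=.
  rewrite (layer_proj_id _ lz); case: eqP => [->|_]; last by rewrite !scaler0.
  by rewrite -powR_mulrn ?powR_ge0 // -powRrM mulVf ?pnatr_eq0 // powRr1 // ltW.
have [s0|s0|->] := ltgtP s 0.
- have -> : s *: y = (- s) *: (- y) by rewrite scaleNr scalerN opprK.
  rewrite ltr0_norm // dil ?oppr_gt0 //.
    by rewrite ler_wpM2l ?powR_ge0 // lerDr hdist0_ge0.
  by rewrite -scaleN1r; apply: (subspaceZ (layer_subspaceS i)).
- by rewrite gtr0_norm // dil // ler_wpM2l ?powR_ge0 // lerDl hdist0_ge0.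
- by rewrite scale0r hdist00 mulr_ge0 ?powR_ge0 ?addr_ge0 ?hdist0_ge0.
Qed.

Lemma exists_neq0 : exists x : G, x != 0.
Proof.
by have [_ [s [_ /eqP]]] := step_nilpotent G; exists (nested_bracket s).
Qed.

(** Finite dimension enters here: the projections are bounded in terms of coordinates, and
    coordinates in terms of the norm. *)
Lemma cvg_layers0 (T : Type) (F : set_system T) {FF : Filter F} (u : T -> G) :
  u @ F --> 0 <-> forall i, (fun t => pr i (u t)) @ F --> (0 : G).
Proof.
split=> [u0 i|up]; last first.
  have -> : u = fun t => \sum_i pr i (u t).
    by apply/funext => t; rewrite layer_proj_sum.
  by apply: cvg_bigsum0.
have [m [b [k [k0 spb kb]]]] := finite_dim_coord spe exists_neq0.
pose K := \sum_j `|pr i (b j)| + 1.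
have K0 : 0 < K by rewrite ltr_wpDl // sumr_ge0.
apply/cvgr0Pnorm_lt => r r0.
have r'0 : 0 < r / K * k by rewrite mulr_gt0 // divr_gt0.
move/cvgr0Pnorm_lt : u0 => /(_ _ r'0); apply: filterS => t ut.
have [c uE] := spb (u t); have kc := kb c; rewrite -uE in kc.
have ck : `|c| < r / K by rewrite -(ltr_pM2r k0) mulrC; apply: le_lt_trans ut.
have : `|pr i (u t)| <= `|c| * K.
  rewrite uE /lincomb linear_sum /=; apply: le_trans (ler_norm_sum _ _ _) _.
  rewrite /K mulrDr mulr1 mulr_sumr ler_wpDr //; apply: ler_sum => j _.
  by rewrite linearZ /= normrZ ler_wpM2r // ler_row_norm.
by move/le_lt_trans; apply; rewrite -ltr_pdivlMr.
Qed.

Lemma cvg_root0 (T : Type) (F : set_system T) {FF : Filter F} (a : T -> R) k :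
  a @ F --> 0 -> (fun t => `|a t| `^ k.+1%:R^-1) @ F --> 0.
Proof.
move=> a0; apply/cvgr0Pnorm_lt => r r0.
have rk0 : 0 < r ^+ k.+1 by rewrite exprn_gt0.
move/cvgr0Pnorm_lt : a0 => /(_ _ rk0); apply: filterS => t at_lt.
rewrite ger0_norm ?powR_ge0 // -(@ltr_pXn2r _ k.+1) ?nnegrE ?powR_ge0 //; last exact: ltW.
by rewrite -powR_mulrn ?powR_ge0 // -powRrM mulVf ?pnatr_eq0 // powRr1.
Qed.

Lemma cvg_squeeze0 (T : Type) (F : set_system T) {FF : Filter F} (u v : T -> R) :
  (forall t, 0 <= u t <= v t) -> v @ F --> 0 -> u @ F --> 0.
Proof.
move=> uv v0; apply: (@squeeze_cvgr _ _ _ _ (fun=> 0) v) => //; last exact: cvg_cst.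
exact: nearW.
Qed.

(* Peeling off one coordinate of the lowest nonzero layer at a time. *)
Lemma cvg_hdist0_low k j (T : Type) (F : set_system T) {FF : Filter F} (u : T -> G) :
  (nu <= j + k)%N -> u @ F --> 0 -> (forall t, low_zero j (u t)) ->
  (fun t => d 0 (u t)) @ F --> 0.
Proof.
have [m [b [c [c0 spb cb]]]] := finite_dim_coord spe exists_neq0.
(* k bounds the number of layers still present; when it is 0, u vanishes identically. *)
elim: k j u => [|k IHk] j u njk u0 lu.
  have -> : (fun t => d 0 (u t)) = fun=> 0.
    apply/funext => t; rewrite (_ : u t = 0) ?hdist00 //.
    by apply: layer_proj_inj => i; rewrite linear0 lu // (leq_trans (ltn_ord i)) // -[j]addn0.
  exact: cvg_cst.
have [nj|jn] := leqP nu j; first by apply: (IHk j) => //; rewrite (leq_trans nj) ?leq_addr.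
pose i := Ordinal jn.
have [a ha] := choice (fun t => spb (u t)).
have a0 l : (fun t => a t 0 l) @ F --> 0.
  apply/cvgr0Pnorm_lt => r r0; have rc0 : 0 < r * c by rewrite mulr_gt0.
  move/cvgr0Pnorm_lt : u0 => /(_ _ rc0); apply: filterS => t ut.
  have ct := cb (a t); rewrite -ha in ct; apply: le_lt_trans (ler_row_norm _ _) _.
  by rewrite -(ltr_pM2r c0) mulrC; apply: le_lt_trans ut.
have ua t : pr i (u t) = \sum_(l <- enum 'I_m.+1) a t 0 l *: pr i (b l).
  rewrite ha /lincomb linear_sum big_enum /=.
  by apply: eq_bigr => l _; rewrite linearZ.
(* The inner induction runs over the coordinates still to be removed from layer j + 1. Once the list
   is empty this layer is gone, and the outer induction applies. *)
elim: (enum _) u u0 lu ua {ha} => [|l s IHs] u u0 lu ua.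
  apply: (IHk j.+1) => //; first by rewrite addSnnS.
  move=> t i'; rewrite ltnS leq_eqVlt => /orP[/eqP i'j|]; last exact: lu.
  by rewrite (_ : i' = i) ?ua ?big_nil //; apply: val_inj.
pose z t := a t 0 l *: pr i (b l).
pose g t := gmul (- z t) (u t).
have z0 : z @ F --> 0 by rewrite -(scale0r (pr i (b l))); apply: cvgZr_tmp.
have lz t : low_zero j (- z t).
  move=> i' i'j; rewrite linearN linearZ /= (layer_proj_id _ (layer_proj_layer i (b l))).
  by rewrite ifN ?scaler0 ?oppr0 // -val_eqE /= ltn_eqF.
have uE t : u t = gmul (z t) (g t) by rewrite gmulA gmulxN gmul0l.
have g0 : (fun t => d 0 (g t)) @ F --> 0.
  apply: IHs.
  - have := cvg_gmul (cvgN z0) u0; rewrite oppr0 gmul0; exact.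
  - move=> t i' i'j; rewrite (layer_proj_gmul (ltnW i'j) (lz t) (lu t)).
    by rewrite lz // lu // addr0.
  - move=> t; rewrite (layer_proj_gmul _ (lz t) (lu t)) // ua big_cons addrA.
    rewrite linearN linearZ /= (layer_proj_id _ (layer_proj_layer i (b l))) eqxx.
    by rewrite addNr add0r.
apply: (cvg_squeeze0 (v := fun t => `|a t 0 l| `^ j.+1%:R^-1 *
    (d 0 (pr i (b l)) + d 0 (- pr i (b l))) + d 0 (g t))).
  move=> t; rewrite hdist0_ge0 {1}uE (le_trans (hdist0M _ _)) // lerD2r.
  exact: (@hdist0_line i _ _ (layer_proj_layer i (b l))).
rewrite -[X in _ --> X]addr0; apply: cvgD => //.
rewrite -(mul0r (d 0 (pr i (b l)) + d 0 (- pr i (b l)))); apply: cvgMr_tmp.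
exact: cvg_root0.
Qed.

Lemma cvg_hdist0 (T : Type) (F : set_system T) {FF : Filter F} (u : T -> G) :
  u @ F --> 0 -> (fun t => d 0 (u t)) @ F --> 0.
Proof. by move=> u0; apply: (@cvg_hdist0_low nu 0) => // t i. Qed.

Lemma cvg_hdist (T : Type) (F : set_system T) {FF : Filter F} (u : T -> G) x :
  u @ F --> x -> (fun t => d x (u t)) @ F --> 0.
Proof.
move=> ux; under eq_fun do rewrite hdistE; apply: cvg_hdist0.
by have := cvg_gmul (cvg_cst (- x)) ux; rewrite gmulNx; apply.
Qed.

Lemma hdist_near x (r : R) : 0 < r -> \forall y \near x, d x y < r.
Proof.
move=> r0; have : (fun y => d x y) @ nbhs x --> 0 by apply: cvg_hdist; apply: cvg_id.
move=> /cvgr0Pnorm_lt /(_ _ r0).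
by apply: filterS => y; apply: le_lt_trans; apply: ler_norm.
Qed.

Lemma dball_open x r : open (dball d x r).
Proof.
rewrite openE => y /=; rewrite /dball /= -subr_gt0 => ry.
have [[_ _ _ dT] _ _] := hd.
apply: filterS (hdist_near y ry) => w; rewrite ltrBrDl => yw.
exact: le_lt_trans (dT x y w) yw.
Qed.

Lemma hdist0_continuous : continuous (d 0).
Proof.
move=> x; apply/cvgrPdist_lt => r r0; apply: filterS (hdist_near x r0) => y.
have [[_ _ dC dT] _ _] := hd.
have := dT 0 x y; have := dT 0 y x; rewrite (dC y x) ltr_norml; lra.
Qed.

Local Notation hn := (@hnorm R G (fun=> 1)).

(** Every nonzero x is dilated to [hn] equal to 1; c is the minimum of d(0, .) on a compact set that
    contains these points and avoids 0. *)
Lemma hdist0_coercive : exists2 c : R, 0 < c & forall x, c * hn x <= d 0 x.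
Proof.
have [m [b [k [k0 spb kb]]]] := finite_dim_coord spe exists_neq0.
pose g (c : 'rV[R]_m.+1) := \sum_i `|pr i (lincomb b c)|.
(* If [hn] is 1, each projection is less than 2^(i + 1), at most 2^nu, which gives C; and g < 1
   would force [hn] < 1. *)
pose C : R := nu%:R * 2 ^+ nu.
pose K := [set c | 1 <= g c] `&` [set c | g c <= C].
have gcont : continuous g.
  have gi i : continuous (fun c => `|pr i (lincomb b c)|).
    have -> : (fun c => `|pr i (lincomb b c)|) =
        fun c => `|lincomb (fun l => pr i (b l)) c|.
      apply/funext => c'; rewrite {1}/lincomb linear_sum /=; congr (`|_|).
      by apply: eq_bigr => l _; rewrite linearZ.
    by move=> c; apply: continuous_comp; [exact: lincomb_continuous|exact: norm_continuous].
  move=> c; apply: (@cvg_bigsum _ R^o _ (nbhs c) (nbhs_filter c)) => i _.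
  exact: gi.
have normalize x : x != 0 -> 0 < hn x /\
    exists2 c, K c & dilation (hn x)^-1 x = lincomb b c.
  move=> x0; have hx0 : 0 < hn x.
    rewrite lt_def hnorm_ge0 andbT; apply: contra_neq x0.
    by apply: hnorm_eq0 => *; apply: ltr01.
  split=> //; have [c cE] := spb (dilation (hn x)^-1 x); exists c => //.
  have hn1 : hn (lincomb b c) = 1.
    by rewrite -cE hnorm_dilation ?invr_gt0 // mulVf // gt_eqF.
  have p1 : forall i, (1 <= i <= nu)%N -> (0 : R) < 1 by move=> *; apply: ltr01.
  split; rewrite /= /g.
    rewrite leNgt; apply/negP => lt1.
    suff : hn (lincomb b c) < 1 by rewrite hn1 ltxx.
    apply/(hnorm_ltP p1) => // i; rewrite divr1 expr1n; apply: le_lt_trans lt1.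
    by rewrite (bigD1 i) //= lerDl sumr_ge0.
  have /(hnorm_ltP p1 _ (ltr0n _ 2)) h2 : hn (lincomb b c) < 2 by rewrite hn1 ltr1n.
  rewrite /C -[X in X%:R * _]card_ord -sum1_card natr_sum mulr_suml; apply: ler_sum => i _.
  rewrite mul1r; apply: le_trans (ltW (h2 i)) _; rewrite divr1 ler_weXn2l ?ler1n //.
have [x0 x0_neq0] := exists_neq0.
have K0 : K !=set0 by have [_ [c Kc _]] := normalize _ x0_neq0; exists c.
have cK : compact K.
  apply: bounded_closed_compact.
    exists (C / k); split; first exact: num_real.
    move=> r Cr c [_ /= gC]; apply: le_trans (ltW Cr).
    rewrite ler_pdivlMr // mulrC; apply: le_trans (kb c) _; apply: le_trans gC.
    by rewrite -{1}[lincomb b c]layer_proj_sum ler_norm_sum.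
  apply: closedI.
    exact: (iffLR (continuous_closedP _) gcont _ (@closed_ge _ 1)).
  exact: (iffLR (continuous_closedP _) gcont _ (@closed_le _ C)).
have [|c cKc cmin] := @compact_EVT_min _ R (fun c => d 0 (lincomb b c)) K K0 cK.
  apply: continuous_subspaceT => c; apply: continuous_comp.
    exact: lincomb_continuous.
  exact: hdist0_continuous.
exists (d 0 (lincomb b c)).
  rewrite lt_def hdist0_ge0 andbT; apply/eqP => /hdist0_eq0 c0.
  move: cKc; rewrite inE => -[/= + _]; rewrite /g c0 big1 ?ler10 // => i _.
  by rewrite linear0 normr0.
move=> x; have [->|xn0] := eqVneq x 0.
  have := @hnorm_dilation R G (fun=> 1) 2 0 (ltr0n _ 2).
  rewrite dilationE (linear0 (weight_map _)) hdist00 => h0.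
  by rewrite (_ : hn 0 = 0) ?mulr0 //; lra.
have [hx0 [c' Kc' cE]] := normalize x xn0.
have := cmin c'; rewrite inE -cE hdist0_dilation ?invr_gt0 // => /(_ Kc').
by rewrite mulrC ler_pdivlMr.
Qed.

Lemma hnorm1_gt0 : forall i, (1 <= i <= nu)%N -> (0 : R) < 1.
Proof. by move=> *; apply: ltr01. Qed.

(** Coercivity turns smallness of d into smallness of all layers; conjugation preserves the latter,
    and the continuity of d at 0 leads back. *)
Lemma hdist0_conj x (r : R) : 0 < r -> exists2 c : R, 0 < c & forall w : G,
  d 0 w < c -> d 0 (gmul (gmul (- x) w) x) < r.
Proof.
move=> r0; pose F := filter_from [set c : R | 0 < c] (fun c => [set w | d 0 w < c]).
have FF : Filter F.
  apply: filter_from_filter; first by exists 1 => /=.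
  move=> c1 c2 /= c10 c20; exists (Num.min c1 c2); rewrite /= ?lt_min ?c10 //.
  by move=> w /=; rewrite lt_min => /andP.
have [c c0 hc] := hdist0_coercive.
have F0 : hn @ F --> 0.
  apply/cvgr0Pnorm_lt => s s0; exists (c * s); first by rewrite /= mulr_gt0.
  move=> w /= dw; rewrite ger0_norm ?hnorm_ge0 // -(ltr_pM2l c0).
  exact: le_lt_trans dw.
have : (fun w => gmul (gmul (- x) w) x) @ F --> 0.
  apply/cvg_layers0; apply: (cvg_layers_conj (u := id)).
  exact: (iffLR (cvg_hnorm0 hnorm1_gt0 (fun w : G => w)) F0).
move=> /cvg_hdist0 /cvgr0Pnorm_lt /(_ _ r0) [c' c'0 hc']; exists c' => // w /hc' /=.
by rewrite ger0_norm ?hdist0_ge0.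
Qed.

(** By coercivity a ball has bounded coordinates, and the corresponding closed ball of coordinates
    is compact. *)
Lemma hdist_totally_bounded (C r : R) : 0 < r ->
  exists s : seq G, forall x, d 0 x < C -> exists2 p, p \in s & d p x < r.
Proof.
move=> r0; have [m [b [k [k0 spb kb]]]] := finite_dim_coord spe exists_neq0.
have [c c0 hc] := hdist0_coercive.
pose h := Num.max C 1 / c; have h0 : 0 < h by rewrite divr_gt0 // lt_max ltr01 orbT.
pose B := \sum_(i < nu) h ^+ i.+1.
pose K := [set a : 'rV[R]_m.+1 | `|a| <= B / k].
have cK : compact K.
  apply: bounded_closed_compact.
    exists (B / k); split; first exact: num_real.
    by move=> s Bs a /= aB; apply: le_trans aB (ltW Bs).
  have nc : continuous (fun c : 'rV[R]_m.+1 => `|c|) by apply: norm_continuous.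
  exact: (iffLR (continuous_closedP _) nc _ (@closed_le _ (B / k))).
move: cK; rewrite compact_cover.
move=> /(_ _ setT (fun a => lincomb b @^-1` dball d (lincomb b a) r)) [].
- move=> a _; apply: open_comp; last exact: dball_open.
  by move=> a' _; apply: lincomb_continuous.
- move=> a _; exists a => //=; rewrite /dball /=.
  by have [[_ d0 _ _] _ _] := hd; rewrite (iffRL (d0 _ _) erefl).
move=> D _ Kcov; exists [seq lincomb b a | a <- finmap.enum_fset D] => x dx.
have [a xE] := spb x.
have Ka : K a.
  rewrite /K /= ler_pdivlMr // mulrC; apply: le_trans (kb a) _; rewrite -xE.
  rewrite -[x]layer_proj_sum; apply: le_trans (ler_norm_sum _ _ _) _.
  apply: ler_sum => i _; have := @hnorm_ltP R G (fun=> 1) hnorm1_gt0 x h h0.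
  have hx : hn x < h.
    rewrite /h ltr_pdivlMr // mulrC; apply: le_lt_trans (hc x) _.
    by apply: lt_le_trans dx _; rewrite le_max lexx.
  by move=> /elimT /(_ hx i); rewrite divr1 => /ltW.
have [a' /= a'D a'x] := Kcov a Ka.
by exists (lincomb b a'); [apply: map_f|rewrite xE].
Qed.

End HomogeneousDistance.

(** * Equivalence of the two forms of the directional derivative *)

Section DerivativeReformulation.
Variables (R : realType) (G M : normed_dil_group R).
Variables (A : set G) (f : G -> M) (L : R).
Hypothesis L_ge0 : 0 <= L.
Hypothesis f_lip : forall x y, A x -> A y -> dg_dist (f x) (f y) <= L * dg_dist x y.
Implicit Types (x p : G) (zeta : G) (D : M) (z : R -> G).

Definition dg_approximates x zeta z : Prop :=
  (forall t, 0 < t -> A (x * z t)%dg) /\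
  (fun t => dg_dist (z t) (dg_dil t zeta) / t) @ 0^'+ --> 0.

Definition dg_derivative x zeta D : Prop :=
  [/\ A x, exists z, dg_approximates x zeta z &
    forall z, dg_approximates x zeta z ->
      (fun t => dg_dist (dg_dil t^-1 ((f x)^-1 * f (x * z t))%dg) D) @ 0^'+ --> 0].

Lemma dg_dist_quotient x p D t : 0 < t ->
  dg_dist (dg_dil t^-1 ((f x)^-1 * f p)%dg) D =
  t^-1 * dg_dist (f p) (f x * dg_dil t D)%dg.
Proof.
move=> t0; rewrite -{1}(dg_dilK D t0) dg_dist_dil ?invr_gt0 //; congr (_ * _).
by rewrite -[LHS](dg_dist_mull (f x)) dg_mulxK.
Qed.

Lemma cvg_right0P (u : R -> R) : (forall t, 0 < t -> 0 <= u t) ->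
  u @ 0^'+ --> 0 <->
  forall e, 0 < e -> exists2 c, 0 < c & forall t, 0 < t < c -> u t < e.
Proof.
move=> u0; split=> [/cvgr0Pnorm_lt uc e /uc|uc].
  move=> [c /= c0 hc]; exists c => // t /andP[t0 tc].
  rewrite -[u t]ger0_norm ?u0 //; apply: hc => //=.
  by rewrite sub0r normrN gtr0_norm.
apply/cvgr0Pnorm_lt => e /uc[c c0 hc]; exists c => // t /= + t0.
by rewrite sub0r normrN gtr0_norm // => tc; rewrite ger0_norm ?u0 // hc ?t0.
Qed.

(** One approximating curve is enough: a nearby point p of A is compared with the point x z(t)
    through the Lipschitz bound. *)
Lemma dg_derivative_dd x zeta D : dg_derivative x zeta D -> dd_at A f x zeta D.
Proof.
move=> [Ax [z hz] lim] e e0; have := lim z hz; have [Az] := hz.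
move=> /cvg_right0P zlim /cvg_right0P flim.
have k0 : 0 < e / (4 * (L + 1)) by rewrite divr_gt0 // mulr_gt0 //; move: L_ge0; lra.
set k := e / _ in k0.
have [|c1 c10 hc1] := zlim _ _ k0.
  by move=> t t0; rewrite divr_ge0 ?dg_dist_ge0 // ltW.
have [|c2 c20 hc2] := flim _ (e / 2) ltac:(by rewrite divr_gt0).
  by move=> t t0; apply: dg_dist_ge0.
exists (Num.min k (Num.min c1 c2)); first by rewrite !lt_min k0 c10.
move=> t p /andP[t0]; rewrite !lt_min => /and3P[_ tc1 tc2] Ap xp.
have := hc1 t; rewrite t0 => /(_ tc1); rewrite ltr_pdivrMr // => zt.
have := hc2 t; rewrite t0 => /(_ tc2); rewrite dg_dist_quotient //.
rewrite mulrC ltr_pdivrMr // => ft.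
have {}xp : dg_dist p (x * dg_dil t zeta)%dg < k * t.
  by apply: lt_le_trans xp _; rewrite ler_pM2r // ge_min lexx.
have h1 := dg_dist_triangle (x * dg_dil t zeta)%dg p (x * z t)%dg.
rewrite (dg_distC (x * dg_dil t zeta)%dg) dg_dist_mull in h1.
have h2 := f_lip Ap (Az t t0).
have h3 := dg_dist_triangle (f (x * z t)%dg) (f p) (f x * dg_dil t D)%dg.
have h4 : L * dg_dist p (x * z t)%dg <= (L + 1) * (2 * (k * t)).
  apply: ler_pM => //; first exact: dg_dist_ge0.
    by rewrite lerDl.
  lra.
have h5 : (L + 1) * (2 * (k * t)) = e / 2 * t.
  have : L + 1 != 0 by rewrite gt_eqF //; move: L_ge0; lra.
  by rewrite /k => L1; field.
lra.
Qed.

Lemma dd_dg_derivative x zeta D : A x -> dense_at A x ->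
  dd_at A f x zeta D -> dg_derivative x zeta D.
Proof.
move=> Ax dx ddx; split=> //; last first.
  move=> z [Az /cvg_right0P zlim]; apply/cvg_right0P => [t t0|e e0].
    exact: dg_dist_ge0.
  have [c c0 hc] := ddx e e0.
  have [|c1 c10 hc1] := zlim _ c c0.
    by move=> t t0; rewrite divr_ge0 ?dg_dist_ge0 // ltW.
  exists (Num.min c c1); first by rewrite lt_min c0.
  move=> t /andP[t0]; rewrite lt_min => /andP[tc tc1].
  rewrite dg_dist_quotient // mulrC ltr_pdivrMr //; apply: hc; rewrite ?t0 //.
    exact: Az.
  by rewrite dg_dist_mull -ltr_pdivrMr //; apply: hc1; rewrite t0.
(* An approximating curve is built from points of A whose distance to x dil_t zeta is within t^2 of
   the infimum. The infimum is o(t) by [dense_at], and so is t^2. *)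
pose S t := [set dg_dist p (x * dg_dil t zeta)%dg | p in A].
have infS t : has_inf (S t).
  split; first by exists (dg_dist x (x * dg_dil t zeta)%dg), x.
  by exists 0 => _ [p _ <-]; apply: dg_dist_ge0.
have exp t : exists p, 0 < t -> A p /\ dg_dist p (x * dg_dil t zeta)%dg < inf (S t) + t * t.
  have [t0|] := ltP 0 t; last by move=> _; exists x.
  by have [_ [p Ap <-] hp] := inf_adherent (mulr_gt0 t0 t0) (infS t); exists p.
have [p hp] := choice exp.
exists (fun t => (x^-1 * p t)%dg); split=> [t t0|].
  by rewrite dg_mulxK; have [] := hp t t0.
apply/cvg_right0P => [t t0|e e0].
  by rewrite divr_ge0 ?dg_dist_ge0 // ltW.
have e2 : 0 < e / 2 by rewrite divr_gt0.
have [c c0 hc] := dx zeta _ e2.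
exists (Num.min c (e / 2)); first by rewrite lt_min c0.
move=> t /andP[t0]; rewrite lt_min => /andP[tc te].
rewrite ltr_pdivrMr // -(dg_dist_mull x) dg_mulxK.
have [_ hpt] := hp t t0; have [q Aq xq] := hc t ltac:(by rewrite t0).
have : inf (S t) <= dg_dist q (x * dg_dil t zeta)%dg.
  by apply: ge_inf; [have [] := infS t|exists q].
nra.
Qed.

Lemma dd_at_dil x zeta D a : 0 < a ->
  dd_at A f x zeta D -> dd_at A f x (dg_dil a zeta) (dg_dil a D).
Proof.
move=> a0 ddx e e0; have [c c0 hc] := ddx (e / a) (divr_gt0 e0 a0).
exists (Num.min (c / a) (c * a)); first by rewrite lt_min divr_gt0 ?mulr_gt0.
move=> t p /andP[t0]; rewrite lt_min => /andP[tc _] Ap; rewrite !dg_dilA => xp.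
have -> : e * t = e / a * (t * a) by rewrite [t * a]mulrC mulrA divfK // gt_eqF.
apply: hc => //; first by rewrite mulr_gt0 //= -ltr_pdivlMr.
apply: lt_le_trans xp _; rewrite [t * a]mulrC mulrA ler_pM2r //.
by rewrite ge_min lexx orbT.
Qed.

End DerivativeReformulation.

(** * Density points *)

(* For [b = 0] and for [b = +oo] the quotient [a / b] is [0]. *)
Lemma ratio_le (R : realType) (a b c : \bar R) (n : nat) : (0 < n)%N ->
  (0 <= a)%E -> (0 <= c)%E -> (a <= b)%E -> (c <= b)%E -> (b <= n%:R%:E * c)%E ->
  (b < +oo -> a <= b - c)%E -> fine (a / b) <= 1 - n%:R^-1.
Proof.
move=> n0 a0 c0 ab cb bc abc.
have n1 : 0 <= 1 - n%:R^-1 :> R by rewrite subr_ge0 invf_le1 ?ler1n ?ltr0n.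
case: b => [r||] in ab cb bc abc *; last first.
- by move: (le_trans a0 ab).
- by rewrite invey mule0.
have /fineK aE : a \is a fin_num by rewrite ge0_fin_numE // (le_lt_trans ab) ?ltry.
have /fineK cE : c \is a fin_num by rewrite ge0_fin_numE // (le_lt_trans cb) ?ltry.
move: a0 c0 ab cb bc abc; rewrite -aE -cE; move: (fine a) (fine c) => {aE cE}{}a {}c.
rewrite -EFinB -EFinM !lee_fin inver => a0 c0 ar cr rn /(_ (ltry r)) arc.
case: eqP => [r0|/eqP r0].
  by rewrite (_ : a = 0) ?mul0e //; apply/eqP; rewrite eq_le a0 -r0 ar.
have {}r0 : 0 < r by rewrite lt_def r0 (le_trans a0).
rewrite -EFinM /= ler_pdivrMr // mulrBl mul1r; apply: le_trans arc _.
by rewrite lerB // mulrC ler_pdivrMr ?ltr0n // mulrC.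
Qed.

Section DensityPoints.
Variables (R : realType) (G : stratified_group R) (d : G -> G -> R).
Hypothesis hd : homogeneous_distance d.
Variables (mu : {measure set (borel G) -> \bar R}).
Hypothesis hmu : is_haar mu.
Variables (n : nat) (e : 'I_n -> G).
Hypothesis spe : spanning e.
Implicit Types (x y : G) (r t : R).

Lemma measurable_dball x r : measurable (dball d x r : set (borel G)).
Proof. by apply: sub_sigma_algebra; apply: (dball_open spe hd). Qed.

Lemma dball_gmul x r : dball d x r = [set gmul x y | y in dball d 0 r].
Proof.
apply/seteqP; split=> [y xy|_ [y xy <-]]; last first.
  by rewrite /dball /= (hdistE hd) gmulA gmulNx gmul0l.
exists (gmul (- x) y); last by rewrite gmulA gmulxN gmul0l.
by rewrite /dball /= -(hdistE hd).
Qed.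

Lemma haar_dball x r : mu (dball d x r) = mu (dball d 0 r).
Proof. by rewrite dball_gmul; have [inv _ _] := hmu; apply: inv; apply: measurable_dball. Qed.

(** A finite cover of the ball of radius C by balls of radius r is dilated by t, so the number of
    balls does not depend on t; all of them have equal measure by invariance. The successor makes k
    positive. *)
Lemma haar_doubling (C r : R) : 0 < r -> exists2 k : nat, (0 < k)%N &
  forall t, 0 < t -> (mu (dball d 0%R (C * t)%R) <= k%:R%:E * mu (dball d 0%R (r * t)%R))%E.
Proof.
move=> r0; have [s hs] := hdist_totally_bounded spe hd C r0.
exists (size s).+1 => // t t0.
apply: (@le_trans _ _ ((size s)%:R%:E * mu (dball d 0%R (r * t)%R))%E); last first.
  by rewrite lee_wpmul2r ?measure_ge0 // lee_fin ler_nat.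
have cover : dball d 0 (C * t) `<=`
    \big[setU/set0]_(p <- s) dball d (dilation t p) (r * t).
  move=> x; rewrite /dball /= => xC.
  have t'0 : 0 < t^-1 by rewrite invr_gt0.
  have [|p ps px] := hs (dilation t^-1 x).
    by rewrite (hdist0_dilation hd) // mulrC ltr_pdivrMr.
  rewrite -bigcup_seq; exists p => //=; have [_ _ ddil] := hd.
  rewrite mulrC -ltr_pdivrMl // -ddil // !dilationM mulVf ?gt_eqF //.
  by rewrite dilation1.
have mb (q : G) : measurable (dball d q (r * t) : set (borel G)) by apply: measurable_dball.
apply: (@le_trans _ _ (mu (\big[setU/set0]_(p <- s) dball d (dilation t p) (r * t)%R))).
  apply: le_measure => //; rewrite inE; first exact: measurable_dball.
  by apply: bigsetU_measurable => p _.
elim: {hs cover} s => [|p s IHs]; first by rewrite big_nil measure0 mul0e.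
rewrite big_cons -nat1r EFinD ge0_muleDl ?lee_fin // mul1e.
rewrite -(haar_dball (dilation t p)); apply: (@le_trans _ _
  (mu (dball d (dilation t p) (r * t)%R) +
   mu (\big[setU/set0]_(q <- s) dball d (dilation t q) (r * t)%R))%E).
  by apply: measureU2 => //; apply: bigsetU_measurable => q _.
by rewrite leeD // (haar_dball (dilation t p)).
Qed.

(** If A missed the ball of radius r t about x dil_t zeta, it would lose at least the fraction 1 / k
    of the ball of radius C t about x, which contains it by the choice of C. *)
Lemma density_dense (A : set G) x zeta r : density_points mu d A x -> 0 < r ->
  exists2 c : R, 0 < c & forall t, 0 < t < c ->
    exists2 p, A p & d p (gmul x (dilation t zeta)) < r * t.
Proof.
move=> dx r0; pose C := d 0 zeta + r.
have C0 : 0 < C by rewrite ltr_wpDl // (hdist0_ge0 hd).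
have [k k0 hk] := haar_doubling C r0.
have k'0 : 0 < k%:R^-1 :> R by rewrite invr_gt0 ltr0n.
have [_ /cvgrPdist_lt /(_ _ k'0) [c /= c0 hc]] := (iffLR (fine_cvgP _ _) dx).
exists (c / C); first by rewrite divr_gt0.
move=> t /andP[t0]; rewrite ltr_pdivlMr // mulrC => tc.
pose p := gmul x (dilation t zeta); apply: contrapT => nA.
have Ct0 : 0 < C * t by rewrite mulr_gt0.
have := hc (C * t); rewrite /= sub0r normrN gtr0_norm // => /(_ tc Ct0).
have [[_ _ dC dT] dl _] := hd.
have sub : dball d p (r * t) `<=` dball d x (C * t).
  move=> y; rewrite /dball /= => py; apply: le_lt_trans (dT x p y) _.
  have -> : d x p = t * d 0 zeta.
    by rewrite (hdistE hd) gmulA gmulNx gmul0l (hdist0_dilation hd).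
  by move: py; rewrite /C; lra.
have mB y s : measurable (dball d y s : set (borel G)) by apply: measurable_dball.
set a := (mu^*)%mu _; set b := (mu^*)%mu _.
have bE : b = mu (dball d x (C * t)) by apply: measurable_mu_extE.
suff h : fine (a / b) <= 1 - k%:R^-1 by rewrite ltr_norml; lra.
apply: (@ratio_le _ _ _ (mu (dball d p (r * t))) _ k0).
- exact: mu_ext_ge0.
- exact: measure_ge0.
- by apply: le_mu_ext; apply: subIsetr.
- by rewrite bE; apply: le_measure => //; rewrite inE.
- by rewrite bE (haar_dball x) (haar_dball p); apply: hk.
- move=> bfin; apply: (@le_trans _ _ (mu (dball d x (C * t) `\` dball d p (r * t)))).
    rewrite -measurable_mu_extE; last by apply: measurableD.
    apply: le_mu_ext => y [Ay xy]; split=> // py; apply: nA; exists y => //.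
    by rewrite dC.
  rewrite bE in bfin *.
  by rewrite measureD // (setIidr sub).
Qed.

End DensityPoints.

(** * Countable dense families *)

Section Separability.
Variables (R : realType) (G : normed_dil_group R).
Hypothesis totally_bounded : forall C r : R, 0 < r ->
  exists s : seq G, forall x, dg_norm x < C -> exists2 i, (i < size s)%N &
    dg_dist (nth (dg_one G) s i) x < r.

Lemma exists_dense_seq : exists a : nat -> G,
  forall x (r : R), 0 < r -> exists n, dg_dist x (a n) < r.
Proof.
have [s hs] := choice (fun k : nat * nat =>
  totally_bounded k.1%:R (r := k.2.+1%:R^-1) ltac:(by rewrite invr_gt0)).
exists (fun n => if unpickle n is Some (k, i) then nth (dg_one G) (s k) i else dg_one G).
move=> x r r0; have [m mr] := exists_invSn_lt r0.
pose C := (Num.truncn (dg_norm x)).+1.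
have xC : dg_norm x < C%:R by apply: truncnS_gt.
have [i _ hi] := hs (C, m) x xC.
exists (pickle ((C, m), i)); rewrite pickleK dg_distC.
exact: lt_trans hi mr.
Qed.

Lemma exists_dense_seq_in (A : set G) : exists b : nat -> G,
  forall x (r : R), A x -> 0 < r -> exists2 n, A (b n) & dg_dist x (b n) < r.
Proof.
have [a ha] := exists_dense_seq.
(* A dense sequence need not meet A; a point of A is chosen in each small ball around its members
   that meets A, and a default value elsewhere. *)
pose P (k : nat * nat) := [set y | A y /\ dg_dist (a k.1) y < k.2.+1%:R^-1].
have exP k : exists y, P k !=set0 -> P k y.
  by have [[y Pky]|nP] := pselect (P k !=set0); [exists y|exists (dg_one G)].
have [b hb] := choice exP.
exists (fun n => if unpickle n is Some k then b k else dg_one G).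
move=> x r Ax r0; have r2 : 0 < r / 2 by rewrite divr_gt0.
have [m mr] := exists_invSn_lt r2.
have [n xn] := ha x m.+1%:R^-1 ltac:(by rewrite invr_gt0).
have [|Ab ab] := hb (n, m); first by exists x; split => //=; rewrite dg_distC.
exists (pickle (n, m)); rewrite pickleK //.
have {}ab : dg_dist (a n) (b (n, m)) < m.+1%:R^-1 := ab.
have := dg_dist_triangle (a n) x (b (n, m)).
by move: m.+1%:R^-1 mr xn ab => q; lra.
Qed.

End Separability.

Theorem theorem1p2 (R : realType)
    (G : stratified_group R) (d : G -> G -> R) (hd : homogeneous_distance d)
    (mu : {measure set (borel G) -> \bar R}) (hmu : is_haar mu)
    (M : banach_homogeneous_group R) (sigma : nat -> R)
    (hsigma : hnorm_constants M sigma)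
    (A : set G) (hA : completed_algebra_gen mu A)
    (f : G -> M) (hf : lipschitz_between d (hdist sigma) A f) :
  exists P : set G, sigma_porous d P /\
    forall x : G, (A `&` density_points mu d A) x -> ~ P x ->
    forall (zeta eta : G) (Dzeta Deta : M),
      is_directional_derivative d (hdist sigma) A f x zeta Dzeta ->
      is_directional_derivative d (hdist sigma) A f x eta Deta ->
      forall a b : R, 0 < a -> 0 < b ->
        is_directional_derivative d (hdist sigma) A f x
          (gmul (dilation a zeta) (dilation b eta))
          (gmul (dilation a Dzeta) (dilation b Deta)).
Proof.
have [_ s0 sM] := hsigma.
have [n [e spe']] := sg_finite_dim G.
have spe : spanning e.
  move=> x; have [c ->] := spe' x; exists (\row_i c i).
  by apply: eq_bigr => i _; rewrite mxE.
(* By left invariance d is the distance of the norm d(0, x), so G fits the interface. *)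
pose G' := @NormedDilGroup R G (@gmul R G) (@ginv R G) 0 (@dilation R G) (d 0)
  (@gmulA R G) (@gmul0l R G) (@gmul0 R G) (@gmulNx R G) (@gmulxN R G)
  (@dilation_gmul R G) (@dilationM R G) (@dilation1 R G)
  (hdist0_ge0 hd) (hdist0_eq0 hd) (hdist0N hd) (hdist0M hd)
  (hdist0_dilation hd) (hdist0_conj spe hd).
pose M' := bhg_normed_dil s0 sM.
have dE : d = @dg_dist R G' by apply/funext => x; apply/funext => y; apply: (hdistE hd).
have [L hL] := hf.
(* A Lipschitz constant as defined may be negative; the estimates need a nonnegative one. *)
pose L' := Num.max L 0.
have L0 : 0 <= L' by rewrite le_max lexx orbT.
have lip (x y : G') : A x -> A y -> dg_dist (f x : M') (f y : M') <= L' * dg_dist x y.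
  move=> Ax Ay; apply: le_trans (hL x y Ax Ay) _; rewrite dE.
  by rewrite ler_wpM2r ?dg_dist_ge0 // le_max lexx.
have tb (C r : R) : 0 < r -> exists s : seq G', forall x, dg_norm x < C ->
    exists2 i, (i < size s)%N & dg_dist (nth (dg_one G') s i) x < r.
  move=> r0; have [s hs] := hdist_totally_bounded spe hd C r0; exists s => x xC.
  have [p ps px] := hs x xC; exists (index p s); first by rewrite index_mem.
  by rewrite -dE nth_index.
have [a ha] := exists_dense_seq tb.
have [b hb] := exists_dense_seq_in tb A.
exists (@exceptional_set R G' M' A f L' a b); split.
  rewrite [X in sigma_porous X]dE.
  exact: (@exceptional_sigma_porous R G' M' A f L' a b).
move=> x [Ax dx] nP zeta eta Dz De hz he r s r0 s0'.
have dense : @dense_at R G' A x.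
  move=> xi q q0; have [c c0 hc] := density_dense hd hmu spe xi dx q0.
  by exists c => // t /hc [p Ap xp]; exists p; rewrite -?dE // dg_distC -dE.
rewrite dE in hz he *.
apply: (@dd_dg_derivative R G' M' A f) => //.
apply: (dd_at_mul L0 lip ha hb) => //.
- by apply: dd_at_dil => //; apply: (dg_derivative_dd L0 lip hz).
- by apply: dd_at_dil => //; apply: (dg_derivative_dd L0 lip he).
Qed.
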